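(* Let $\Phi$ be a finite indecomposable root system and let $\lambda\in\mathfrak A$ be an element of the fundamental alcove. Then $$P\left(W_\lambda^{\mathrm{aff}}/W_\lambda\right)=1+\sum_{\xi_\beta}t^{\ell_{\xi_\beta}}\,P\left(W_\lambda/W_{\lambda,\xi_\beta}\right),$$ where $P(W_\lambda^{\mathrm{aff}}/W_\lambda):=P(W_\lambda^{\mathrm{aff}})/P(W_\lambda)$ and the summation is over all those elements $\xi_\beta=\sum_{\beta'\in\mathcal K,\ \beta'\preccurlyeq\beta}\beta'$, with $\beta\in\mathcal K$, which are dominant and satisfy $(\xi_\beta,\xi_\beta)=2(\xi_\beta,\lambda)$.
   Context: Setting: $\Phi$ is a finite indecomposable (reduced, crystallographic) root system with real span $\mathbf R\Phi$, basis $\Delta$ of simple roots, and Weyl group $W$. If all roots have the same length, all roots are called short. The $W$-invariant scalar product $(\,,\,)$ on $\mathbf R\Phi$ is normalised so that $(\alpha,\alpha)=2$ for all short roots $\alpha$; $\beta^\vee=2\beta/(\beta,\beta)$. An element $\mu\in\mathbf R\Phi$ is dominant if $(\mu,\alpha^\vee)\ge 0$ for all $\alpha\in\Delta$. $\beta_1$ denotes the largest short root (the unique dominant short root); note $\beta_1^\vee=\beta_1$. Affine Weyl group: $W^{\mathrm{aff}}=W\ltimes\mathbf Z\Phi$ is the group of affine transformations of $\mathbf R\Phi$ generated by $W$ and all translations by roots (not coroots). It is a Coxeter group with Coxeter generators $s_\alpha$ ($\alpha\in\Delta$) and $s_0$, the affine reflection in the hyperplane $\{x: (x,\beta_1)=1\}$;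 $l$ denotes its length function (which restricts to the length function of $W$). The fundamental alcove is $\mathfrak A=\{\mu\in\mathbf R\Phi: (\mu,\alpha^\vee)\ge0 \text{ for all }\alpha\in\Delta,\ (\mu,\beta_1^\vee)\le1\}$. For $\lambda\in\mathfrak A$, $W_\lambda$ and $W^{\mathrm{aff}}_\lambda$ are the stabilisers of $\lambda$ in $W$ and in $W^{\mathrm{aff}}$. For a finite subgroup $H$ generated by a subset of the Coxeter generators, $P(H)=\sum_{w\in H}t^{l(w)}$ is its Poincaré polynomial. For dominant $\xi$, $W_\xi$ is its stabiliser in $W$, $W_{\lambda,\xi}=W_\lambda\cap W_\xi$, and $P(W_\lambda/W_{\lambda,\xi}):=P(W_\lambda)/P(W_{\lambda,\xi})$ (a polynomial). Exponents: for a nonzero dominant $\xi\in\mathbf Z\Phi$, let $\widetilde W_\xi$ be the (finite) subgroup of $W^{\mathrm{aff}}$ generated by $W_\xi$ and $s_0$; then $\ell_\xi:=\deg\left(P(\widetilde W_\xi)/P(W_\xi)\right)$. Kostant cascade (version with short roots): ''short'' always means short in $\Phi$; connectedness of subsets of $\Delta$ is in the Dynkin diagram. For a connected $I\subset\Delta$ containing a short simple root let $\beta_I$ be the largest short root of $\Phi\cap\mathbf ZI$ (the unique short root in it with $(\beta_I,\alpha)\ge0$ for all $\alpha\in I$). Start with the subset $\Delta$; whenever a subset $I$ has been obtained, also add every connected component of $\{\alpha\in I:(\beta_I,\alpha)=0\}$ that contains a short simple root. $\mathcal K$ is the set of all $\beta_I$ for the subsets $I$ so obtained. For $\beta=\beta_I\in\mathcal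 K$ put $\Delta(\beta)=I$ (equal to the support of $\beta$). $\beta\in\mathcal K$ is the predecessor of $\beta'\in\mathcal K$ if $\Delta(\beta')$ is a connected component of $\{\alpha\in\Delta(\beta):(\beta,\alpha)=0\}$; $\preccurlyeq$ is the partial order on $\mathcal K$ with $\beta\preccurlyeq\beta'$ iff $\beta=\beta'$ or there is a chain $\beta=\beta^{(1)},\dots,\beta^{(s)}=\beta'$ in $\mathcal K$ with each $\beta^{(i)}$ the predecessor of $\beta^{(i+1)}$. Thus $\beta_1$ is the smallest element for $\preccurlyeq$. *)

(* Defs.v *)
From HB Require Import structures.
From mathcomp Require Import all_boot all_order all_algebra finmap.
From mathcomp Require Import boolp classical_sets cardinality fsbigop reals.

Set Implicit Arguments.
Unset Strict Implicit.
Unset Printing Implicit Defensive.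

Import Order.TTheory GRing.Theory Num.Theory.

Local Open Scope classical_set_scope.
Local Open Scope ring_scope.

Section Groups.
Variable T : Type.

Definition transformation_group (G : set (T -> T)) :=
  [/\ G idfun,
      forall f g, G f -> G g -> G (f \o g) &
      forall f g, G f -> cancel f g -> cancel g f -> G g].

Definition generated (S : set (T -> T)) : set (T -> T) :=
  smallest transformation_group S.

Definition stabiliser (G : set (T -> T)) (x : T) : set (T -> T) :=
  [set g | G g /\ g x = x].

End Groups.

Section Roots.
Variables (R : realType) (V : vectType R) (form : {dot V for idfun}).

Definition coroot (a : V) : V := (2 / form a a) *: a.

(* Affine reflection in the hyperplane {x | (x, a) = k * (a, a) / 2}, i.e.
   {x | (x, a^v) = k}. *)
Definition affine_reflection (a : V) (k : R) (x : V) : V :=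
  x - (form x (coroot a) - k) *: a.

Definition reflection (a : V) : V -> V := affine_reflection a 0.

Definition translation (a : V) (x : V) : V := x + a.

(* If all the roots have the same length, then all of them are short. *)
Definition short (Phi : seq V) (a : V) : bool :=
  (a \in Phi) && all (fun b => form a a <= form b b) Phi.

End Roots.

(* A finite, reduced, crystallographic, indecomposable root system spanning V,
   with a basis of simple roots and a scalar product normalised on short roots.
   Invariance of the scalar product under the Weyl group is automatic, because
   the reflections of the root system are orthogonal for it. *)
Record rootSystem (R : realType) (V : vectType R) := RootSystem {
  form : {dot V for @idfun R};
  roots : seq V;
  rank : nat;
  simple : rank.-tuple V;
  roots_span : <<roots>>%VS = fullv;
  roots_neq0 : 0 \notin roots;
  roots_refl : {in roots &, forall a b, reflection form a b \in roots};
  roots_cryst : {in roots &, forall a b,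
    exists m : int, form b (coroot form a) = m%:~R};
  roots_reduced : {in roots, forall a (c : R),
    c *: a \in roots -> c = 1 \/ c = -1};
  roots_nonempty : roots != [::];
  roots_indec : forall S : pred V,
    (exists2 a, a \in roots & S a) -> (exists2 b, b \in roots & ~~ S b) ->
    exists a b, [/\ a \in roots, S a, b \in roots, ~~ S b & form a b != 0];
  form_short : forall a, short form roots a -> form a a = 2;
  simple_roots : {subset simple <= roots};
  simple_basis : basis_of fullv simple;
  simple_sign : {in roots, forall a, exists c : 'I_rank -> nat,
    a = \sum_(i < rank) tnth simple i *+ c i \/
    a = - \sum_(i < rank) tnth simple i *+ c i}
}.

Section WithRootSystem.
Variables (R : realType) (V : vectType R) (D : rootSystem V).

Local Notation "'[ u , v ]" := (form D u v) (at level 0).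
Local Notation alpha := (tnth (simple D)).
Local Notation shortD := (short (form D) (roots D)).
Local Notation subD := {set 'I_(rank D)}.

(* Subsets of the set of simple roots are represented by their index sets. *)

Definition lattice_span (I : subD) : set V :=
  [set v | exists c : 'I_(rank D) -> int, v = \sum_(i in I) alpha i *~ c i].

(* The largest short root of the subsystem spanned by I; it is only meaningful
   for I connected and containing a short simple root, in which case exactly
   one element satisfies the condition. *)
Definition largest_short (I : subD) : V :=
  xget 0 [set b | [/\ shortD b, lattice_span I b &
                      forall i, i \in I -> 0 <= '[b, alpha i]]].

Definition beta1 : V := largest_short [set: 'I_(rank D)]%SET.

Definition dominant (mu : V) : Prop :=
  forall i, 0 <= '[mu, coroot (form D) (alpha i)].

Definition fundamental_alcove : set V :=
  [set mu | dominant mu /\ '[mu, coroot (form D) beta1] <= 1].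

Definition weyl : set (V -> V) :=
  generated [set reflection (form D) a | a in [set` roots D]].

Definition affine_weyl : set (V -> V) :=
  generated (weyl `|` [set @translation R V a | a in [set` roots D]]).

Definition s0 : V -> V := affine_reflection (form D) beta1 1.

(* The Coxeter generators: [None] stands for [s0]. *)
Definition coxeter_generator (o : option 'I_(rank D)) : V -> V :=
  if o is Some i then reflection (form D) (alpha i) else s0.

Definition word_eval (s : seq (option 'I_(rank D))) : V -> V :=
  foldr (fun o f => coxeter_generator o \o f) idfun s.

Definition length (w : V -> V) : nat :=
  xget 0%N [set k | (exists2 s, word_eval s = w & size s = k) /\
                    (forall s, word_eval s = w -> (k <= size s)%N)].

(* For finite H; the finitely supported sum has the value 0 otherwise. *)
Definition poincare (H : set (V -> V)) : {poly rat} :=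
  \sum_(w \in H) ('X^(length w) : {poly rat}).

Definition poincare_quotient (H K : set (V -> V)) : {fraction {poly rat}} :=
  tofrac (poincare H) / tofrac (poincare K).

Definition ext_stabiliser (xi : V) : set (V -> V) :=
  generated (stabiliser weyl xi `|` [set s0]).

(* [poincare (stabiliser weyl xi)] divides [poincare (ext_stabiliser xi)],
   since these are Poincare polynomials of Coxeter groups, the former being a
   standard parabolic subgroup of the latter. *)
Definition ell (xi : V) : nat :=
  (size (poincare (ext_stabiliser xi) %/ poincare (stabiliser weyl xi))).-1.

Definition dynkin_edge (S : subD) : rel 'I_(rank D) :=
  fun i j => [&& i \in S, j \in S, i != j & '[alpha i, alpha j] != 0].

Definition components (S : subD) : {set subD} :=
  [set [set j | connect (dynkin_edge S) i j] | i in S]%SET.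

Definition cascade_step (I J : subD) : bool :=
  (J \in components [set i in I | '[largest_short I, alpha i] == 0]%SET) &&
  [exists i in J, shortD (alpha i)].

Definition cascade_subset (I : subD) : bool :=
  connect cascade_step [set: 'I_(rank D)]%SET I.

Definition cascade : set V :=
  [set largest_short I | I in [set I | cascade_subset I]].

(* The index set I attached to b = largest_short I in the cascade is unique: it
   is the support of b. *)
Definition cascade_pred (b b' : V) : Prop :=
  exists I J, [/\ cascade_subset I /\ cascade_subset J,
    b = largest_short I, b' = largest_short J &
    J \in components [set i in I | '[largest_short I, alpha i] == 0]%SET].

Inductive cascade_le (b : V) : V -> Prop :=
| cascade_le_refl : cascade_le b b
| cascade_le_step b' b'' :
    cascade_le b b' -> cascade_pred b' b'' -> cascade_le b b''.

Definition cascade_sum (b : V) : V :=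
  \sum_(b' \in [set b' | cascade b' /\ cascade_le b' b]) b'.

Definition summation_set (lambda : V) : set V :=
  [set xi | [/\ exists2 b, cascade b & xi = cascade_sum b, dominant xi &
                '[xi, xi] = 2 * '[xi, lambda]]].

End WithRootSystem.

(* Main.v *)
(** The coset space of the stabiliser of lambda in the affine Weyl group modulo
    W_lambda is the orbit of 0, which consists of the root lattice points
    nearest to lambda, i.e. with (v, v) = 2 (v, lambda).  Every W_lambda-orbit
    of nearest points contains exactly one dominant point xi, and the shortest
    elements sending the points of its orbit to 0 have length
    L(xi) + (length of a shortest element of W_lambda making the point dominant),
    where L(xi) is the number of positive roots a with (xi, a^v) = 2.  This
    gives the formula, with L(xi) = ell_xi because W_xi and the group generated
    by W_xi and s_0 are the stabilisers of xi / 4 and xi / 2 in the affine Weyl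
    group, and a longest element of the stabiliser of a point of the alcove
    crosses every hyperplane through that point.

    To identify the nonzero dominant nearest points with the xi_beta, write
    a lattice point v as a sum of as few roots as possible: then
    (v, a) >= (a, a) for every term a, while (lambda, a^v) <= 1.  Hence
    (v, v) >= 2 (v, lambda), and for a nearest point all terms satisfy
    (lambda, a^v) = 1.  If v is moreover dominant, then v - beta_1 is again
    nearest and orthogonal to beta_1, so it is a sum of positive roots supported
    on the simple roots orthogonal to beta_1; two different components of these
    cannot both occur, because otherwise (lambda, beta_1) >= 2.  One concludes
    by induction along the cascade.

    Lengths are computed by counting hyperplanes: [crossing w a] is the signed
    number of hyperplanes orthogonal to the image of the root a under the linear
    part of w that separate the fundamental alcove from its image under w. *)

Require Import Defs.
From mathcomp Require Import all_boot all_order all_algebra finmap.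
From mathcomp Require Import boolp classical_sets cardinality fsbigop reals.
From mathcomp Require Import ring lra.

Set Implicit Arguments.
Unset Strict Implicit.
Unset Printing Implicit Defensive.

Import Order.TTheory GRing.Theory Num.Theory.

Local Open Scope classical_set_scope.
Local Open Scope ring_scope.

Local Notation form := Defs.form.
Local Notation roots := Defs.roots.

(** * The invariant scalar product and the roots *)

Section RootGeometry.
Variables (R : realType) (V : vectType R) (D : rootSystem V).

Local Notation "'[ u , v ]" := (form D u v) (at level 0).
Local Notation shortD := (short (form D) (roots D)).

Lemma formC u v : '[u, v] = '[v, u].
Proof. by rewrite hermC expr0 mul1r. Qed.

Lemma formDl u v w : '[u + v, w] = '[u, w] + '[v, w].
Proof. by rewrite linearDl. Qed.

Lemma formDr u v w : '[w, u + v] = '[w, u] + '[w, v].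
Proof. by rewrite linearDr. Qed.

Lemma formNl u w : '[- u, w] = - '[u, w].
Proof. by rewrite linearNl. Qed.

Lemma formNr u w : '[w, - u] = - '[w, u].
Proof. by rewrite linearNr. Qed.

Lemma formBl u v w : '[u - v, w] = '[u, w] - '[v, w].
Proof. by rewrite formDl formNl. Qed.

Lemma formBr u v w : '[w, u - v] = '[w, u] - '[w, v].
Proof. by rewrite formDr formNr. Qed.

Lemma formZl c u w : '[c *: u, w] = c * '[u, w].
Proof. by rewrite linearZl_LR. Qed.

Lemma formZr c u w : '[w, c *: u] = c * '[w, u].
Proof. by rewrite formC formZl formC. Qed.

Lemma form0l w : '[0, w] = 0.
Proof. by rewrite linear0l. Qed.

Lemma form_suml (I : Type) (r : seq I) (P : pred I) (F : I -> V) w :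
  '[\sum_(i <- r | P i) F i, w] = \sum_(i <- r | P i) '[F i, w].
Proof. by rewrite linear_sumlz. Qed.

Lemma form_sumr (I : Type) (r : seq I) (P : pred I) (F : I -> V) w :
  '[w, \sum_(i <- r | P i) F i] = \sum_(i <- r | P i) '[w, F i].
Proof. by rewrite linear_sumr. Qed.

Definition formE := (formDl, formDr, formNl, formNr, formZl, formZr).

Lemma form_gt0 v : v != 0 -> 0 < '[v, v].
Proof. exact: neq0_dnorm_gt0. Qed.


Lemma form_eq0 v : ('[v, v] == 0) = (v == 0).
Proof.
have [->|v0] := eqVneq v 0; first by rewrite form0l eqxx.
by rewrite gt_eqF // form_gt0.
Qed.

Definition pairing (x a : V) : R := '[x, coroot (form D) a].

Lemma pairingE x a : pairing x a = 2 * '[x, a] / '[a, a].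
Proof. by rewrite /pairing /coroot formZr; ring. Qed.

Lemma pairingDl x y a : pairing (x + y) a = pairing x a + pairing y a.
Proof. exact: formDl. Qed.

Lemma pairingBl x y a : pairing (x - y) a = pairing x a - pairing y a.
Proof. exact: formBl. Qed.

Lemma pairingNl x a : pairing (- x) a = - pairing x a.
Proof. exact: formNl. Qed.

Lemma pairingZl c x a : pairing (c *: x) a = c * pairing x a.
Proof. exact: formZl. Qed.

Lemma pairing0l a : pairing 0 a = 0.
Proof. exact: form0l. Qed.

Lemma pairing_suml (I : Type) (r : seq I) (P : pred I) (F : I -> V) a :
  pairing (\sum_(i <- r | P i) F i) a = \sum_(i <- r | P i) pairing (F i) a.
Proof. exact: form_suml. Qed.

Lemma pairingNr x a : pairing x (- a) = - pairing x a.
Proof. by rewrite !pairingE !formE opprK mulrN mulNr. Qed.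

Lemma reflectionE a x : reflection (form D) a x = x - pairing x a *: a.
Proof. by rewrite /reflection /affine_reflection subr0. Qed.

Lemma root_neq0 a : a \in roots D -> a != 0.
Proof. by move=> aR; apply: contraNneq (roots_neq0 D) => <-. Qed.

Lemma root_norm_gt0 a : a \in roots D -> 0 < '[a, a].
Proof. by move/root_neq0/form_gt0. Qed.

Lemma form_pairing x a : a \in roots D -> '[x, a] = pairing x a * '[a, a] / 2.
Proof. by move=> /root_norm_gt0 a0; rewrite pairingE; field; rewrite gt_eqF. Qed.

Lemma pairing_self a : a \in roots D -> pairing a a = 2.
Proof. by move=> /root_norm_gt0 a0; rewrite pairingE; field; rewrite gt_eqF. Qed.

Lemma pairing_gt0 x a : a \in roots D -> (0 < pairing x a) = (0 < '[x, a]).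
Proof.
move=> /root_norm_gt0 a0; rewrite pairingE -mulrA mulrCA.
by rewrite pmulr_lgt0 // mulr_gt0 // invr_gt0.
Qed.

Lemma pairing_eq0 x a : a \in roots D -> (pairing x a == 0) = ('[x, a] == 0).
Proof.
move=> aR; rewrite form_pairing // !mulf_eq0 invr_eq0 pnatr_eq0 orbF.
by rewrite (gt_eqF (root_norm_gt0 aR)) orbF.
Qed.

Lemma pairing_lt0 x a : a \in roots D -> (pairing x a < 0) = ('[x, a] < 0).
Proof.
by move=> aR; rewrite -[LHS]oppr_gt0 -pairingNl pairing_gt0 // formNl oppr_gt0.
Qed.

Lemma pairing_ge0 x a : a \in roots D -> (0 <= pairing x a) = (0 <= '[x, a]).
Proof. by move=> aR; rewrite !leNgt pairing_lt0. Qed.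

Lemma refl_root a b : a \in roots D -> b \in roots D ->
  b - pairing b a *: a \in roots D.
Proof. by move=> aR bR; rewrite -reflectionE; apply: roots_refl. Qed.

Lemma root_opp a : a \in roots D -> - a \in roots D.
Proof.
move=> aR; have := refl_root aR aR; rewrite pairing_self // scaler_nat mulr2n.
by rewrite opprD addrA subrr sub0r.
Qed.

Lemma root_oppE a : (- a \in roots D) = (a \in roots D).
Proof. by apply/idP/idP => /root_opp //; rewrite opprK. Qed.

Lemma pairing_int a b : a \in roots D -> b \in roots D ->
  pairing b a \is a Num.int.
Proof. by move=> aR bR; have [m E] := roots_cryst aR bR; rewrite /pairing E intr_int. Qed.

Lemma short_root a : shortD a -> a \in roots D.
Proof. by case/andP. Qed.

Lemma short_norm a : shortD a -> '[a, a] = 2.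
Proof. exact: form_short. Qed.

Lemma exists_short : exists a, shortD a.
Proof.
have [s [sR /allP sP]] : exists a, a \in roots D /\
    all (fun b => '[a, a] <= '[b, b]) (roots D).
  elim: (roots D) (roots_nonempty D) => // a s IH _.
  have [s0|s0] := eqVneq s [::].
    by exists a; rewrite s0 inE eqxx /= lexx.
  have [b [bs /allP ab]] := IH s0.
  have [ab0|ba0] := leP '[a, a] '[b, b].
    exists a; rewrite inE eqxx; split=> //=; rewrite lexx /=.
    by apply/allP => c /ab; apply: le_trans.
  exists b; rewrite inE bs orbT; split=> //=; rewrite (ltW ba0) /=.
  exact/allP.
by exists s; rewrite /short sR; apply/allP.
Qed.

Lemma root_norm_ge2 a : a \in roots D -> 2 <= '[a, a].
Proof.
move=> aR; have [s sS] := exists_short; rewrite -(short_norm sS).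
by have /andP[_ /allP/(_ _ aR)] := sS.
Qed.

Lemma shortE a : shortD a = (a \in roots D) && ('[a, a] == 2).
Proof.
apply/idP/andP => [aS|[aR /eqP a2]].
  by rewrite short_root ?short_norm.
by rewrite /short aR; apply/allP => b /root_norm_ge2; rewrite a2.
Qed.

Lemma short_opp a : shortD a -> shortD (- a).
Proof. by rewrite !shortE root_oppE formNl formNr opprK. Qed.

Lemma pairing_short x a : shortD a -> pairing x a = '[x, a].
Proof. by move=> /short_norm a2; rewrite pairingE a2; field. Qed.

Lemma refl_norm a b : a \in roots D ->
  '[b - pairing b a *: a, b - pairing b a *: a] = '[b, b].
Proof.
move=> /root_norm_gt0 a0; rewrite !formE (formC a b) pairingE.
by field; rewrite gt_eqF.
Qed.

Lemma short_refl a b : a \in roots D -> shortD b -> shortD (b - pairing b a *: a).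
Proof.
by move=> aR; rewrite !shortE => /andP[bR b2]; rewrite refl_root // refl_norm.
Qed.

Lemma int_lt_le1 (x y : R) : x \is a Num.int -> y \is a Num.int ->
  x < y -> x + 1 <= y.
Proof.
move=> /intrP[m ->] /intrP[n ->]; rewrite ltr_int -lezD1.
by rewrite -(ler_int R) intrD.
Qed.

(** Positivity of (b - a, b - a) with [b] no longer than [a] makes the pairing smaller than 2, and
    it is an integer. *)
Lemma pairing_le1 a b : a \in roots D -> b \in roots D ->
  '[b, b] <= '[a, a] -> b != a -> pairing b a <= 1.
Proof.
move=> aR bR ba bDa; have a0 := root_norm_gt0 aR.
suff : pairing b a < 2.
  by move=> /(int_lt_le1 (pairing_int aR bR) (rpred_nat _ 2)); lra.
have : 0 < '[b - a, b - a] by rewrite form_gt0 // subr_eq0.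
rewrite !formE (formC a b) pairingE ltr_pdivrMr //; lra.
Qed.

Lemma pairing_geN1 a b : a \in roots D -> b \in roots D ->
  '[b, b] <= '[a, a] -> b != - a -> - 1 <= pairing b a.
Proof.
move=> aR bR ba bDa; rewrite lerNl -pairingNl.
apply: pairing_le1; rewrite ?root_oppE ?formE ?opprK //.
by rewrite -(inj_eq oppr_inj) opprK.
Qed.

(** If [b] is the shorter root and not [- a], its pairing with [a] is a negative integer not below
    -1, so reflecting [b] in [a] gives [a + b]. *)
Lemma root_add a b : a \in roots D -> b \in roots D -> '[a, b] < 0 ->
  (a + b \in roots D) \/ b = - a.
Proof.
wlog ba : a b / '[b, b] <= '[a, a].
  move=> W aR bR ab; have [h|h] := leP '[b, b] '[a, a]; first exact: W.
  have ba : '[b, a] < 0 by rewrite formC.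
  have [H|H] := W b a (ltW h) bR aR ba; first by left; rewrite addrC.
  by right; rewrite H opprK.
move=> aR bR ab; have [->|bDa] := eqVneq b (- a); first by right.
left; have := pairing_geN1 aR bR ba bDa.
have := int_lt_le1 (pairing_int aR bR) (rpred0 _).
rewrite pairing_lt0 // formC => /(_ ab) h1 h2.
have /eqP p1 : pairing b a == -1 by rewrite eq_le; apply/andP; split; lra.
by have := refl_root aR bR; rewrite p1 scaleN1r opprK addrC.
Qed.

End RootGeometry.

(** * Coordinates with respect to the simple roots *)

Section Coordinates.
Variables (R : realType) (V : vectType R) (D : rootSystem V).

Local Notation "'[ u , v ]" := (form D u v) (at level 0).
Local Notation alpha := (tnth (simple D)).
Local Notation subD := {set 'I_(rank D)}.
Local Notation pairing := (pairing D).

Definition co (i : 'I_(rank D)) (v : V) : R := coord (simple D) i v.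

Lemma coD i u v : co i (u + v) = co i u + co i v.
Proof. exact: linearD. Qed.

Lemma coN i v : co i (- v) = - co i v.
Proof. exact: linearN. Qed.

Lemma coZ i c v : co i (c *: v) = c * co i v.
Proof. exact: linearZ. Qed.

Lemma co0 i : co i 0 = 0.
Proof. exact: linear0. Qed.

Lemma co_sum i (I : Type) (r : seq I) (P : pred I) (F : I -> V) :
  co i (\sum_(j <- r | P j) F j) = \sum_(j <- r | P j) co i (F j).
Proof. exact: linear_sum. Qed.

Lemma coE v : v = \sum_i co i v *: alpha i.
Proof.
rewrite {1}(coord_basis (simple_basis D) (memvf v)).
by apply: eq_bigr => i _; rewrite (tnth_nth 0).
Qed.

Lemma co_simple i j : co j (alpha i) = (i == j)%:R.
Proof.
rewrite /co (tnth_nth 0) coord_free //; exact: basis_free (simple_basis D).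
Qed.

Lemma co_inj u v : (forall i, co i u = co i v) -> u = v.
Proof. by move=> uv; rewrite [u]coE [v]coE; apply: eq_bigr => i _; rewrite uv. Qed.

Lemma form_co x v : '[x, v] = \sum_i co i v * '[x, alpha i].
Proof. by rewrite {1}[v]coE form_sumr; apply: eq_bigr => i _; rewrite formZr. Qed.

Lemma simple_root i : alpha i \in roots D.
Proof. exact/simple_roots/mem_tnth. Qed.

Lemma co_root a : a \in roots D -> exists c : 'I_(rank D) -> nat,
  (forall i, co i a = (c i)%:R) \/ (forall i, co i a = - (c i)%:R).
Proof.
have E (c : 'I_(rank D) -> nat) i :
    co i (\sum_(j < rank D) alpha j *+ c j) = (c i)%:R.
  rewrite co_sum (bigD1 i) //= -scaler_nat coZ co_simple eqxx mulr1.
  rewrite big1 ?addr0 // => j ji.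
  by rewrite -scaler_nat coZ co_simple (negbTE ji) mulr0.
move=> aR; have [c [ac|ac]] := simple_sign aR; exists c; [left|right] => i.
  by rewrite ac E.
by rewrite ac coN E.
Qed.

Definition positive (v : V) : bool := [forall i, 0 <= co i v].

Lemma positiveP v : reflect (forall i, 0 <= co i v) (positive v).
Proof. exact: forallP. Qed.

Lemma co_int i a : a \in roots D -> co i a \is a Num.int.
Proof. by move=> /co_root[c [->|->]]; rewrite ?rpredN rpred_nat. Qed.

Lemma root_sign a : a \in roots D -> positive a \/ positive (- a).
Proof.
move=> /co_root[c [h|h]]; [left|right]; apply/positiveP => i.
  by rewrite h.
by rewrite coN h opprK.
Qed.

Lemma positive_simple i : positive (alpha i).
Proof. by apply/positiveP => j; rewrite co_simple. Qed.

Lemma neq0_co v : v != 0 -> exists i, co i v != 0.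
Proof.
move=> v0; apply/existsP; apply: contra_neqT v0 => /existsPn h.
by apply: co_inj => i; rewrite co0; apply/eqP; rewrite -[_ == _]negbK h.
Qed.

Lemma positive_opp a : a \in roots D -> positive (- a) = ~~ positive a.
Proof.
move=> aR; have [pa|pa] := root_sign aR; last first.
  rewrite pa; symmetry; apply/negP => pa'.
  have [i /negP[]] := neq0_co (root_neq0 aR).
  have /positiveP/(_ i) := pa; have /positiveP/(_ i) := pa'.
  by rewrite coN oppr_ge0 => h1 h2; rewrite eq_le h1 h2.
rewrite pa; apply/negP => pa'.
have [i /negP[]] := neq0_co (root_neq0 aR).
have /positiveP/(_ i) := pa; have /positiveP/(_ i) := pa'.
by rewrite coN oppr_ge0 => h1 h2; rewrite eq_le h1 h2.
Qed.

Lemma co_gt0_positive a i : a \in roots D -> 0 < co i a -> positive a.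
Proof.
move=> aR ai; have [//|/positiveP/(_ i)] := root_sign aR.
by rewrite coN oppr_ge0 leNgt ai.
Qed.

(** The reflection of [alpha i] in [alpha j] has coefficient 1 at [i], hence is positive, and its
    coefficient at [j] is minus the pairing. *)
Lemma simple_offdiag i j : i != j -> '[alpha i, alpha j] <= 0.
Proof.
move=> ij; rewrite leNgt -(pairing_gt0 _ (simple_root j)); apply/negP => h.
have rR := refl_root (simple_root j) (simple_root i).
have ci : co i (alpha i - pairing (alpha i) (alpha j) *: alpha j) = 1.
  by rewrite coD coN coZ !co_simple eqxx eq_sym (negbTE ij) mulr0 subr0.
have := co_gt0_positive rR; move=> /(_ i); rewrite ci ltr01 => /(_ isT).
move=> /positiveP/(_ j); rewrite coD coN coZ !co_simple eqxx (negbTE ij).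
by rewrite mulr1 sub0r oppr_ge0 leNgt h.
Qed.

Lemma co_refl_simple i j v : j != i ->
  co j (v - pairing v (alpha i) *: alpha i) = co j v.
Proof.
by move=> ji; rewrite coD coN coZ co_simple eq_sym (negbTE ji) mulr0 subr0.
Qed.

(** Only the coefficient at [i] changes. By reducedness another coefficient is nonzero, and it
    determines the sign. *)
Lemma positive_refl_simple i a : a \in roots D -> positive a -> a != alpha i ->
  positive (a - pairing a (alpha i) *: alpha i).
Proof.
move=> aR /positiveP pa ai.
have [j /andP[ji cj]|H] := pickP [pred j | (j != i) && (co j a != 0)].
  apply: (@co_gt0_positive _ j); first exact: refl_root (simple_root i) aR.
  by rewrite co_refl_simple // lt_def cj pa.
have aE : a = co i a *: alpha i.
  rewrite {1}[a]coE (bigD1 i) //= big1 ?addr0 // => j ji.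
  by have := H j; rewrite /= ji /= => /negbFE/eqP ->; rewrite scale0r.
have [c1|c1] : co i a = 1 \/ co i a = -1.
- apply: (@roots_reduced _ _ D (alpha i)); first exact: simple_root.
  by rewrite -aE.
- by move: ai; rewrite aE c1 scale1r eqxx.
- by have := pa i; rewrite c1 oppr_ge0 ler10.
Qed.

Definition supported (I : subD) (v : V) : bool :=
  [forall i, (i \notin I) ==> (co i v == 0)].

Lemma supportedP (I : subD) v :
  reflect (forall i, i \notin I -> co i v = 0) (supported I v).
Proof.
apply: (iffP forallP) => h i; first by move/(implyP (h i))/eqP.
by apply/implyP => /h ->.
Qed.

Lemma supportedD I u v : supported I u -> supported I v -> supported I (u + v).
Proof.
move=> /supportedP hu /supportedP hv; apply/supportedP => i iI.
by rewrite coD hu // hv // addr0.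
Qed.

Lemma supportedZ I c v : supported I v -> supported I (c *: v).
Proof.
by move=> /supportedP hv; apply/supportedP => i iI; rewrite coZ hv // mulr0.
Qed.

Lemma supportedN I v : supported I v -> supported I (- v).
Proof. by rewrite -scaleN1r; apply: supportedZ. Qed.

Lemma supported_sum I (J : eqType) (r : seq J) (F : J -> V) :
  (forall j, j \in r -> supported I (F j)) -> supported I (\sum_(j <- r) F j).
Proof.
move=> h; apply/supportedP => i iI; rewrite co_sum big_seq big1 // => j /h.
by move=> /supportedP/(_ i iI).
Qed.

Lemma supported_simple (I : subD) i : i \in I -> supported I (alpha i).
Proof.
move=> iI; apply/supportedP => j jI; rewrite co_simple.
by case: eqP => // ij; rewrite -ij iI in jI.
Qed.

Lemma supportedT v : supported [set: 'I_(rank D)]%SET v.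
Proof. by apply/supportedP => i; rewrite finset.inE. Qed.

Lemma form_supported (I : subD) x v : supported I v ->
  '[x, v] = \sum_(i in I) co i v * '[x, alpha i].
Proof.
move=> /supportedP h; rewrite form_co (bigID (mem I)) /= [X in _ + X]big1 ?addr0 //.
by move=> i /h ->; rewrite mul0r.
Qed.

Definition dominant_on (I : subD) (v : V) : Prop :=
  forall i, i \in I -> 0 <= '[v, alpha i].

Lemma dominant_on_form (I : subD) x v : dominant_on I x -> supported I v ->
  positive v -> 0 <= '[x, v].
Proof.
move=> dx sv /positiveP pv; rewrite (form_supported x sv) sumr_ge0 // => i iI.
by rewrite mulr_ge0 // dx.
Qed.

Lemma dominant_positive (I : subD) x a : dominant_on I x -> supported I a ->
  a \in roots D -> 0 < '[x, a] -> positive a.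
Proof.
move=> dx sa aR xa; have [//|pa] := root_sign aR.
by have := dominant_on_form dx (supportedN sa) pa; rewrite formNr oppr_ge0 leNgt xa.
Qed.

Definition lattice : set V := [set v | forall i, co i v \is a Num.int].

Lemma lattice_spanE (I : subD) v :
  lattice_span I v <-> supported I v /\ lattice v.
Proof.
split=> [[c ->]|[/supportedP sv vL]].
  have E j : co j (\sum_(i in I) alpha i *~ c i) = if j \in I then (c j)%:~R else 0.
    rewrite co_sum; have [jI|jI] := boolP (j \in I).
      rewrite (bigD1 j) //= -scaler_int coZ co_simple eqxx mulr1 big1 ?addr0 //.
      by move=> i /andP[_ ij]; rewrite -scaler_int coZ co_simple (negbTE ij) mulr0.
    rewrite big1 // => i iI; rewrite -scaler_int coZ co_simple.
    by case: eqP => [ij|]; rewrite ?mulr0 //; rewrite -ij iI in jI.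
  split; first by apply/supportedP => j /negbTE jI; rewrite E jI.
  by move=> j; rewrite E; case: ifP; rewrite ?rpred0 ?intr_int.
exists (fun i => Num.floor (co i v)); rewrite {1}[v]coE (bigID (mem I)) /=.
rewrite [X in _ + X]big1 ?addr0 => [|i /sv ->]; last by rewrite scale0r.
by apply: eq_bigr => i _; rewrite -scaler_int; have /floorK -> := vL i.
Qed.

Lemma lattice0 : lattice 0.
Proof. by move=> i; rewrite co0 rpred0. Qed.

Lemma latticeD u v : lattice u -> lattice v -> lattice (u + v).
Proof. by move=> uL vL i; rewrite coD rpredD. Qed.

Lemma latticeN v : lattice v -> lattice (- v).
Proof. by move=> vL i; rewrite coN rpredN. Qed.

Lemma latticeZ c v : c \is a Num.int -> lattice v -> lattice (c *: v).
Proof. by move=> cZ vL i; rewrite coZ rpredM. Qed.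

Lemma lattice_root a : a \in roots D -> lattice a.
Proof. by move=> aR i; apply: co_int. Qed.

Lemma pairing_lattice v a : lattice v -> a \in roots D ->
  pairing v a \is a Num.int.
Proof.
move=> vL aR; rewrite [v]coE pairing_suml rpred_sum // => i _.
by rewrite pairingZl rpredM // pairing_int // simple_root.
Qed.

Lemma lattice_refl v a : lattice v -> a \in roots D ->
  lattice (v - pairing v a *: a).
Proof.
move=> vL aR; apply/latticeD/latticeN/latticeZ => //.
  exact: pairing_lattice.
exact: lattice_root.
Qed.

(** The height, the measure for climbing and descending through the roots by simple reflections. *)
Definition ht (v : V) : R := \sum_i co i v.

Lemma htB u v : ht (u - v) = ht u - ht v.
Proof.
by rewrite /ht -sumrB; apply: eq_bigr => i _; rewrite coD coN.
Qed.

Lemma htZ c v : ht (c *: v) = c * ht v.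
Proof. by rewrite /ht mulr_sumr; apply: eq_bigr => i _; rewrite coZ. Qed.

Lemma ht_simple i : ht (alpha i) = 1.
Proof.
rewrite /ht (bigD1 i) //= co_simple eqxx big1 ?addr0 // => j ji.
by rewrite co_simple eq_sym (negbTE ji).
Qed.

Lemma ht_refl_simple v i : ht (v - pairing v (alpha i) *: alpha i) =
  ht v - pairing v (alpha i).
Proof. by rewrite htB htZ ht_simple mulr1. Qed.

End Coordinates.

(** * Induction along a real-valued function on a finite list *)

Section FiniteInduction.
Variables (R : realDomainType) (T : eqType).

(** Induction on the number of entries of [s] with a larger value of [f]. *)
Lemma seq_ind_gt (s : seq T) (f : T -> R) (P : T -> Prop) :
  (forall a, a \in s -> (forall b, b \in s -> f a < f b -> P b) -> P a) ->
  forall a, a \in s -> P a.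
Proof.
move=> IH a; have [n] := ubnP (count (fun b => f a < f b) s).
elim: n a => // n IHn a; rewrite ltnS => ca aS; apply: IH => // b bs ab.
apply: IHn => //; apply: leq_trans ca.
rewrite -!sum1_count [X in (_ < X)%N](bigID (fun c => f b < f c)) /=.
rewrite [X in (_ < X + _)%N](eq_bigl (fun c => f b < f c)) => [|c]; last first.
  by apply: andb_idl; apply: lt_trans.
rewrite -addn1 leq_add2l sum1_count -has_count; apply/hasP; exists b => //=.
by rewrite ab ltxx.
Qed.

End FiniteInduction.

(** * Dominant short roots *)

Section DominantShortRoots.
Variables (R : realType) (V : vectType R) (D : rootSystem V).

Local Notation "'[ u , v ]" := (form D u v) (at level 0).
Local Notation alpha := (tnth (simple D)).
Local Notation subD := {set 'I_(rank D)}.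
Local Notation shortD := (short (form D) (roots D)).
Local Notation pairing := (pairing D).
Local Notation ht := (ht D).
Local Notation positive := (positive D).
Local Notation supported := (@supported _ _ D).
Local Notation dominant_on := (@dominant_on _ _ D).
Local Notation coroot := (coroot (form D)).

(** Connectedness is expressed by cuts rather than paths, the form that [full_support] uses and that
    indecomposability yields. *)
Definition connected (I : subD) : Prop := forall S : subD,
  S \subset I -> S != finset.set0 -> S != I ->
  exists i j, [/\ i \in S, j \in I, j \notin S & '[alpha i, alpha j] != 0].

(** Otherwise every term in the expansion of (v, v) along the simple roots would be at most 0. *)
Lemma exists_form_gt0 (I : subD) v : v != 0 -> supported I v -> positive v ->
  exists2 i, i \in I & 0 < '[v, alpha i].
Proof.
move=> v0 sv /positiveP pv; apply: contrapT => h.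
have := form_gt0 D v0; rewrite (form_supported v sv) ltNge => /negP; apply.
rewrite sumr_le0 // => i iI; rewrite mulr_ge0_le0 // leNgt.
by apply/negP => ?; apply: h; exists i.
Qed.

(** If the set [S] of indices with positive coefficient were proper, an edge from [S] to some [j]
    outside it would make (v, alpha j) negative. *)
Lemma full_support (I : subD) v : connected I -> supported I v -> positive v ->
  v != 0 -> dominant_on I v -> forall i, i \in I -> 0 < co i v.
Proof.
move=> cI sv pv v0 dv; pose S : subD := [set i in I | 0 < co i v]%SET.
have [SI|SI] := eqVneq S I.
  by move=> i; rewrite -SI finset.inE => /andP[].
have [||i [j [iS jI jS ij]]] := cI S _ _ SI.
- by apply/fintype.subsetP => i; rewrite finset.inE => /andP[].
- have [i iI vi] := exists_form_gt0 v0 sv pv.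
  have [k vk] := neq0_co D v0.
  apply/set0Pn; exists k; rewrite finset.inE lt_def vk (positiveP _ _ pv) andbT.
  by rewrite andbT; apply: contraNT vk => kI; rewrite (supportedP _ _ sv).
move: iS jS; rewrite !finset.inE jI /= => /andP[iI vi] vj.
have := dv j jI; rewrite formC (form_supported _ sv) leNgt => /negP[].
rewrite (bigD1 i) //= -ltrBDr sub0r.
have iDj : i != j by apply: contra vj => /eqP <-.
have vj0 : co j v = 0.
  by apply/eqP; rewrite eq_le (positiveP _ _ pv) leNgt vj.
apply: (@lt_le_trans _ _ 0).
  by rewrite pmulr_rlt0 // lt_neqAle formC ij simple_offdiag.
rewrite oppr_ge0 sumr_le0 // => k /andP[kI ki].
have [->|kj] := eqVneq k j; first by rewrite vj0 mul0r.
by rewrite mulr_ge0_le0 // ?(positiveP _ _ pv) // formC simple_offdiag.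
Qed.

Lemma dominant_root_positive (I : subD) a : a \in roots D -> supported I a ->
  dominant_on I a -> positive a.
Proof.
by move=> aR sa da; apply: (dominant_positive da) => //; apply: root_norm_gt0.
Qed.

(** Expand along [b]: all its coefficients on [I] are positive, and [a] has nonnegative products
    with the simple roots of [I], one of them positive. *)
Lemma dominant_roots_form_gt0 (I : subD) a b : connected I ->
  a \in roots D -> supported I a -> dominant_on I a ->
  b \in roots D -> supported I b -> dominant_on I b -> 0 < '[a, b].
Proof.
move=> cI aR sa da bR sb db.
have pa := dominant_root_positive aR sa da.
have pb := dominant_root_positive bR sb db.
have [i iI ai] := exists_form_gt0 (root_neq0 aR) sa pa.
rewrite (form_supported _ sb) (bigD1 i) //= ltr_pwDl //.
  by rewrite mulr_gt0 // (full_support cI) // (root_neq0 bR).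
by apply: sumr_ge0 => j /andP[jI _]; rewrite mulr_ge0 ?da // (positiveP _ _ pb).
Qed.

(* Reflecting upwards we may assume that c is dominant on I; then - s_b c is a
   positive root, and b - c^v is a positive multiple of it plus a nonnegative
   multiple of b. *)
Lemma coroot_le_dominant_short (I : subD) b c : connected I ->
  shortD b -> supported I b -> dominant_on I b ->
  c \in roots D -> supported I c -> forall i : 'I_(rank D), co i (coroot c) <= co i b.
Proof.
move=> cI bS sb db; have bR := short_root bS; have b2 := short_norm bS.
have pb := dominant_root_positive bR sb db.
move: c; apply: (@seq_ind_gt _ _ (roots D) ht) => c cR IH sc.
have c0 := root_norm_gt0 cR.
have [/exists_inP[j jI cj]|] := boolP [exists j in I, '[c, alpha j] < 0].
  set c' := c - pairing c (alpha j) *: alpha j.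
  have c'R : c' \in roots D by apply: refl_root => //; apply: simple_root.
  have pj : pairing c (alpha j) < 0 by rewrite pairing_lt0 ?simple_root.
  have c'c (i : 'I_(rank D)) : co i c <= co i c'.
    rewrite coD coN coZ co_simple lerDl oppr_ge0 mulr_le0_ge0 //.
    exact: ltW.
  move=> i; apply: le_trans (IH c' c'R _ _ i).
  - rewrite !coZ refl_norm ?simple_root // ler_wpM2l //.
    by rewrite divr_ge0 // ltW.
  - by rewrite ht_refl_simple ltrDl oppr_gt0.
  - by rewrite supportedD ?supportedN ?supportedZ ?supported_simple.
move=> /exists_inPn dc'.
have dc : dominant_on I c by move=> i /dc'; rewrite -leNgt.
have [->|cb] := eqVneq c b; first by move=> i; rewrite coZ b2 divff ?mul1r ?pnatr_eq0.
have m0 := dominant_roots_form_gt0 cI cR sc dc bR sb db.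
have dR : - (c - pairing c b *: b) \in roots D by rewrite root_oppE refl_root.
have dP : positive (- (c - pairing c b *: b)).
  apply: (dominant_positive db) => //.
    by rewrite supportedN ?supportedD ?supportedN ?supportedZ.
  rewrite !formE b2 (formC D b c) pairing_short //; lra.
have p1 : pairing b c <= 1.
  by apply: pairing_le1; rewrite // 1?eq_sym // b2 root_norm_ge2.
move=> i; have := positiveP _ _ dP i; have := positiveP _ _ pb i.
rewrite coN coD coN !coZ pairing_short // => bi ci.
move: ci; rewrite oppr_ge0 subr_le0 => ci.
apply: (@le_trans _ _ (pairing b c * co i b)); last by rewrite ler_piMl.
have -> : pairing b c * co i b = 2 / '[c, c] * ('[c, b] * co i b).
  by rewrite pairingE (formC D b); ring.
rewrite ler_wpM2l //.
by rewrite divr_ge0 // ltW.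
Qed.

Lemma exists_dominant_short (I : subD) a : shortD a -> supported I a ->
  exists b, [/\ shortD b, supported I b & dominant_on I b].
Proof.
move=> aS; have aR := short_root aS; move: a aR aS.
apply: (@seq_ind_gt _ _ (roots D) ht) => a aR IH aS sa.
have [/exists_inP[j jI aj]|] := boolP [exists j in I, '[a, alpha j] < 0].
  have jR := simple_root j.
  apply: (IH _ (refl_root jR aR)).
  - by rewrite ht_refl_simple ltrDl oppr_gt0 pairing_lt0.
  - exact: short_refl.
  - by rewrite supportedD ?supportedN ?supportedZ ?supported_simple.
move=> /exists_inPn da; exists a; split=> // i /da; by rewrite -leNgt.
Qed.

Definition short_connected (I : subD) : Prop :=
  connected I /\ exists a, shortD a /\ supported I a.

Lemma largest_shortP (I : subD) : short_connected I ->
  [/\ shortD (largest_short I), supported I (largest_short I) &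
      dominant_on I (largest_short I)].
Proof.
case=> _ [a [aS sa]]; have [b [bS sb db]] := exists_dominant_short aS sa.
rewrite /largest_short; set P := (X in xget 0 X).
have [|h1 /lattice_spanE[h2 _] h3] := @xgetPex _ 0 P; last by [].
exists b; split=> //; apply/lattice_spanE; split=> //.
exact/lattice_root/short_root.
Qed.

Lemma co_largest_short (I : subD) : short_connected I -> forall i,
  (0 < co i (largest_short I)) = (i \in I).
Proof.
move=> cI; have [h1 h2 h3] := largest_shortP cI.
have bR := short_root h1 => i; apply/idP/idP => [|iI].
  by apply: contraTT => iI; rewrite (supportedP _ _ h2) // ltxx.
apply: (full_support (proj1 cI)) => //; last first.
  exact: root_neq0 bR.
exact: (dominant_root_positive bR h2).
Qed.

Lemma largest_short_inj (I J : subD) : short_connected I -> short_connected J ->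
  largest_short I = largest_short J -> I = J.
Proof.
move=> cI cJ IJ; apply/finset.setP => i.
by rewrite -(co_largest_short cI) IJ co_largest_short.
Qed.

(** Descend from a positive root to a simple one by simple reflections; none of them can join the
    two orthogonal halves. *)
Lemma root_support_split (I S : subD) a : S \subset I ->
  (forall i j, i \in S -> j \in I -> j \notin S -> '[alpha i, alpha j] = 0) ->
  a \in roots D -> supported I a -> supported S a \/ supported (I :\: S)%SET a.
Proof.
move=> SI orth; pose T (b : bool) : subD := if b then S else (I :\: S)%SET.
have orthT b i j : i \in T b -> j \in I -> j \notin T b -> '[alpha i, alpha j] = 0.
  case: b => /=; first exact: orth.
  rewrite !finset.inE => /andP[iS iI] jI; rewrite jI andbT negbK => jS.
  by rewrite formC orth.
suff H c : c \in roots D -> positive c -> supported I c -> exists b, supported (T b) c.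
  move=> aR sa; have [pa|pa] := root_sign aR.
    by have [[] h] := H a aR pa sa; [left|right].
  have [|[] h] := H (- a) _ pa (supportedN sa); rewrite ?root_oppE //.
    by left; rewrite -[a]opprK supportedN.
  by right; rewrite -[a]opprK supportedN.
move: c; apply: (@seq_ind_gt _ _ (roots D) (fun v => - ht v)) => c cR IH pc sc.
have [i iI ci] := exists_form_gt0 (root_neq0 cR) sc pc.
have [cE|cDi] := eqVneq c (alpha i).
  exists (i \in S); rewrite cE /T; case: ifP => iS; apply: supported_simple => //.
  by rewrite finset.inE iS.
have iR := simple_root i.
have p0 : 0 < pairing c (alpha i) by rewrite pairing_gt0.
have [|||b sb] := IH _ (refl_root iR cR).
- by rewrite ht_refl_simple ltrN2 gtrBl.
- exact: positive_refl_simple.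
- by rewrite supportedD ?supportedN ?supportedZ ?supported_simple.
exists b; have [iT|iT] := boolP (i \in T b).
  rewrite -[c](subrK (pairing c (alpha i) *: alpha i)).
  by rewrite supportedD // supportedZ // supported_simple.
(* For [i] outside [T b] the reflected root would be orthogonal to [alpha i], but its product with
   [alpha i] is minus the positive one of [c]. *)
have : '[c - pairing c (alpha i) *: alpha i, alpha i] = 0.
  rewrite formC (form_supported _ sb) big1 // => j jT.
  by rewrite formC (orthT b) ?mulr0.
have := form_pairing c iR; have := mulr_gt0 p0 (root_norm_gt0 iR).
rewrite !formE; lra.
Qed.

(** If no edge left [S], every root would be supported in [S] or in its complement, and roots of the
    two kinds are orthogonal, against indecomposability. *)
Lemma connectedT : connected [set: 'I_(rank D)]%SET.
Proof.
move=> S _ /set0Pn[i iS]; rewrite -finset.properT => /properP[_ [j _ jS]].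
apply: contrapT => h.
have orth k l : k \in S -> l \in [set: 'I_(rank D)]%SET -> l \notin S ->
    '[alpha k, alpha l] = 0.
  by move=> kS lT lS; apply/eqP; apply: contrapT => /negP kl; apply: h; exists k, l.
have NS k : k \notin S -> ~~ supported S (alpha k).
  move=> kS; apply/negP => /supportedP/(_ k kS)/eqP.
  by rewrite co_simple eqxx oner_eq0.
have [a [b [aR sa bR nsb]]] := @roots_indec _ _ D (supported S)
  (ex_intro2 _ _ (alpha i) (simple_root i) (supported_simple iS))
  (ex_intro2 _ _ (alpha j) (simple_root j) (NS j jS)).
have [sb|sb] := root_support_split (finset.subsetT S) orth bR (supportedT D b).
  by rewrite sb in nsb.
move=> /eqP[]; rewrite formC (form_supported _ sa) big1 // => k kS.
rewrite formC (form_supported _ sb) big1 ?mulr0 // => l.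
by rewrite !finset.inE andbT => lS; rewrite orth ?mulr0 // finset.inE.
Qed.

Lemma short_connectedT : short_connected [set: 'I_(rank D)]%SET.
Proof.
split; first exact: connectedT.
by have [a aS] := exists_short D; exists a; split=> //; apply: supportedT.
Qed.

End DominantShortRoots.

(** * Lattice points nearest to a point of the alcove *)

Section NearestLatticePoints.
Variables (R : realType) (V : vectType R) (D : rootSystem V).

Local Notation "'[ u , v ]" := (form D u v) (at level 0).
Local Notation alpha := (tnth (simple D)).
Local Notation subD := {set 'I_(rank D)}.
Local Notation shortD := (short (form D) (roots D)).
Local Notation pairing := (pairing D).
Local Notation ht := (ht D).
Local Notation positive := (positive D).
Local Notation supported := (@supported _ _ D).
Local Notation dominant_on := (@dominant_on _ _ D).
Local Notation coroot := (coroot (form D)).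
Local Notation lattice := (lattice D).
Local Notation beta1 := (beta1 D).

Lemma short_beta1 : shortD beta1.
Proof. by have [] := largest_shortP (short_connectedT D). Qed.

Lemma dominant_beta1 i : 0 <= '[beta1, alpha i].
Proof. by have [_ _] := largest_shortP (short_connectedT D); apply. Qed.

Lemma root_beta1 : beta1 \in roots D.
Proof. exact: short_root short_beta1. Qed.

Lemma positive_beta1 : positive beta1.
Proof.
apply: (dominant_root_positive root_beta1 (supportedT D _)) => i _.
exact: dominant_beta1.
Qed.

Lemma dominantE v : dominant D v <-> forall i, 0 <= '[v, alpha i].
Proof.
split=> h i; last by rewrite -/(pairing v (alpha i)) pairing_ge0 ?simple_root.
have : 0 <= pairing v (alpha i) := h i.
by rewrite pairing_ge0 ?simple_root.
Qed.

Lemma pairing_co x a : pairing x a = \sum_i co i (coroot a) * '[x, alpha i].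
Proof. exact: form_co. Qed.

(** Weight the coefficientwise bound on coroots by the nonnegative products of [x] with the simple
    roots. This is why the single wall of [beta1] bounds the alcove in every direction. *)
Lemma pairing_le_largest (I : subD) b x a : connected I ->
  shortD b -> supported I b -> dominant_on I b -> dominant_on I x ->
  a \in roots D -> supported I a -> pairing x a <= '[x, b].
Proof.
move=> cI bS sb db dx aR sa; rewrite pairing_co form_co ler_sum // => i _.
have [iI|iI] := boolP (i \in I).
  by rewrite ler_wpM2r ?dx // (coroot_le_dominant_short cI).
by rewrite coZ (supportedP _ _ sa) // (supportedP _ _ sb) // mulr0.
Qed.

Section Alcove.
Variables (lambda : V) (hlambda : fundamental_alcove D lambda).

Lemma alcove_simple i : 0 <= '[lambda, alpha i].
Proof. by case: hlambda => /dominantE. Qed.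

Lemma alcove_beta1 : '[lambda, beta1] <= 1.
Proof.
have [_] : _ /\ pairing lambda beta1 <= 1 := hlambda.
by rewrite pairing_short ?short_beta1.
Qed.

Lemma alcove_le1 a : a \in roots D -> pairing lambda a <= 1.
Proof.
move=> aR; have [c1 c2 c3] := largest_shortP (short_connectedT D).
apply: le_trans alcove_beta1.
have dl : dominant_on [set: 'I_(rank D)]%SET lambda.
  by move=> i _; apply: alcove_simple.
exact (pairing_le_largest (@connectedT _ _ D) c1 c2 c3 dl aR (supportedT D a)).
Qed.

Lemma alcove_geN1 a : a \in roots D -> -1 <= pairing lambda a.
Proof.
by move=> aR; rewrite lerNl -pairingNr alcove_le1 // root_oppE.
Qed.

Lemma alcove_ge0 a : positive a -> 0 <= '[lambda, a].
Proof.
apply: (@dominant_on_form _ _ _ [set: 'I_(rank D)]%SET); last exact: supportedT.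
by move=> i _; apply: alcove_simple.
Qed.

Lemma alcove_positive a : a \in roots D -> 0 < '[lambda, a] -> positive a.
Proof.
apply: (@dominant_positive _ _ _ [set: 'I_(rank D)]%SET); last exact: supportedT.
by move=> i _; apply: alcove_simple.
Qed.

End Alcove.

(** * Lattice points as sums of roots *)

Definition root_sum (I : subD) (v : V) (s : seq V) : Prop :=
  (forall a, a \in s -> a \in roots D /\ supported I a) /\ v = \sum_(a <- s) a.

Lemma root_sum_exists (I : subD) v : supported I v -> lattice v ->
  exists s, root_sum I v s.
Proof.
move=> sv vL; pose Q v := exists s, root_sum I v s.
have Q0 : Q 0 by exists [::]; split; rewrite ?big_nil.
have QD u w : Q u -> Q w -> Q (u + w).
  move=> [s [sR ->]] [t [tR ->]]; exists (s ++ t); rewrite /root_sum big_cat.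
  by split=> // a; rewrite mem_cat => /orP[/sR|/tR].
have Qr a : a \in roots D -> supported I a -> Q a.
  move=> aR sa; exists [:: a]; rewrite /root_sum big_seq1; split=> // b.
  by rewrite inE => /eqP ->.
have QM n a : a \in roots D -> supported I a -> Q (a *+ n).
  move=> aR sa; elim: n => [|n IH]; first by rewrite mulr0n.
  by rewrite mulrS; apply: QD => //; apply: Qr.
rewrite -/(Q v) (coE D v); apply: (big_ind Q) => // i _.
have [iI|iI] := boolP (i \in I); last first.
  by rewrite (supportedP _ _ sv) // scale0r.
have iR := simple_root i; have si := supported_simple iI.
have /intrP[m ->] := vL i; case: m => n; first by rewrite scaler_nat; apply: QM.
rewrite NegzE mulrNz scaleNr scaler_nat -mulNrn; apply: QM.
  by rewrite root_oppE.
exact: supportedN.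
Qed.

(* In a shortest expression as a sum of roots, any two terms have nonnegative
   product, since otherwise their sum would be a root or zero. *)
Lemma root_sum_acute (I : subD) v : supported I v -> lattice v ->
  exists s, root_sum I v s /\ forall a, a \in s -> '[a, a] <= '[a, v].
Proof.
move=> sv vL; have [s0 hs0] := root_sum_exists sv vL.
have ex : exists n, `[< exists s, root_sum I v s /\ size s = n >].
  by exists (size s0); apply/asboolP; exists s0.
case: (ex_minnP ex) => n /asboolP[s [hs sn]] min_n; exists s; split=> // a aS.
have [sR vE] := hs; have [aR sa] := sR a aS.
rewrite vE (perm_big _ (perm_to_rem aS)) big_cons /= formDr lerDl form_sumr.
rewrite big_seq sumr_ge0 // => b bS; rewrite leNgt; apply/negP => ab.
have bS' : b \in s := mem_rem bS; have [bR sb] := sR b bS'.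
pose t := rem b (rem a s).
have vE' : v = (a + b) + \sum_(c <- t) c.
  rewrite vE (perm_big _ (perm_to_rem aS)) big_cons /=.
by rewrite (perm_big _ (perm_to_rem bS)) big_cons /= addrA.
have tR c : c \in t -> c \in roots D /\ supported I c.
  by move=> /mem_rem/mem_rem/sR.
have st : size s = (size t).+2.
  by rewrite (perm_size (perm_to_rem aS)) /= (perm_size (perm_to_rem bS)).
have [abR|bE] := root_add aR bR ab.
  have := min_n (size t).+1; rewrite -sn st ltnn => H; have /H // : `[< exists
      s, root_sum I v s /\ size s = (size t).+1 >].
  apply/asboolP; exists ((a + b) :: t); split=> //; split; last by rewrite big_cons.
  move=> c; rewrite inE => /orP[/eqP ->|/tR //]; split=> //; exact: supportedD.
have := min_n (size t); rewrite -sn st; have -> : ((size t).+2 <= size t)%N = false.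
  by rewrite leqNgt ltnS leqnSn.
move=> H; apply/notF/H; apply/asboolP; exists t; split=> //; split=> //.
by rewrite vE' bE subrr add0r.
Qed.

Section Nearest.
Variables (lambda : V) (hlambda : fundamental_alcove D lambda).

(* [nearest v] says that the lattice point [v] is as close to [lambda] as 0. *)
Definition nearest (v : V) : Prop := lattice v /\ '[v, v] = 2 * '[v, lambda].

(** Each term of an acute expression satisfies 2 (a, lambda) <= (a, a) <= (a, v). Geometrically, no
    lattice point is closer to [lambda] than 0. *)
Lemma lattice_norm_ge v : lattice v -> 2 * '[v, lambda] <= '[v, v].
Proof.
move=> vL; have [s [[sR vE] hs]] := root_sum_acute (supportedT D v) vL.
rewrite {1 2}vE !form_suml mulr_sumr big_seq [leRHS]big_seq ler_sum // => a aS.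
have [aR _] := sR a aS; apply: le_trans (hs a aS).
rewrite formC form_pairing //.
have := alcove_le1 hlambda aR; have := root_norm_gt0 aR; nra.
Qed.

(** Equality in [lattice_norm_ge] forces equality in every term. *)
Lemma nearest_root_sum (I : subD) v : supported I v -> nearest v ->
  exists s, root_sum I v s /\
    forall a, a \in s -> pairing lambda a = 1 /\ '[a, a] <= '[a, v].
Proof.
move=> sv [vL vN]; have [s [hs hv]] := root_sum_acute sv vL.
exists s; split=> // a aS; split; last exact: hv.
have [sR vE] := hs.
have h b : b \in s -> 0 <= '[b, v] - 2 * '[b, lambda].
  move=> bS; have [bR _] := sR b bS; have := hv b bS.
  rewrite (formC D b lambda) (form_pairing lambda bR).
  have := alcove_le1 hlambda bR; have := root_norm_gt0 bR; nra.
have : \sum_(b <- s | b \in s) ('[b, v] - 2 * '[b, lambda]) = 0.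
  by rewrite -big_seq sumrB -mulr_sumr -!form_suml -vE vN subrr.
move/eqP; rewrite psumr_eq0 // => /allP/(_ a aS)/implyP/(_ aS)/eqP.
have [aR _] := sR a aS; have := hv a aS.
rewrite (formC D a lambda) (form_pairing lambda aR).
have := alcove_le1 hlambda aR; have := root_norm_gt0 aR => n0 l1 h1 h2.
by apply/eqP; rewrite eq_le l1 /=; nra.
Qed.

Lemma pairing_gt0_positive a : a \in roots D -> 0 < pairing lambda a -> positive a.
Proof. by move=> aR; rewrite pairing_gt0 //; apply: alcove_positive. Qed.

(** Meeting a short root spreads along non-orthogonal roots: if the short root [e] meets [c], and
    [c] meets [d], then [e] or its reflection in [c] meets [d]. Indecomposability carries this to
    all roots. *)
Lemma exists_short_form_neq0 a : a \in roots D -> exists2 b, shortD b & 0 < '[b, a].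
Proof.
move=> aR; suff [b bS ba] : exists2 b, shortD b & '[b, a] != 0.
  case: (ltP 0 '[b, a]) => [h|h]; first by exists b.
  exists (- b); first exact: short_opp.
  by rewrite formNl oppr_gt0 lt_neqAle ba.
pose S (c : V) := `[< exists2 b, shortD b & '[b, c] != 0 >].
have [/asboolP //|naS] := boolP (S a).
have [b bS] := exists_short D.
have Sb : S b.
  apply/asboolP; exists b => //; rewrite gt_eqF //.
  exact: root_norm_gt0 (short_root bS).
have [c [d [cR /asboolP[e eS ec] dR nSd cd]]] := @roots_indec _ _ D S
  (ex_intro2 _ _ b (short_root bS) Sb) (ex_intro2 _ _ a aR naS).
have dO f : shortD f -> '[f, d] = 0.
  move=> fS; apply/eqP; apply: contraNT nSd => fd; apply/asboolP; by exists f.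
have := dO _ (short_refl cR eS); rewrite !formE dO // sub0r => /eqP.
by rewrite oppr_eq0 mulf_eq0 pairing_eq0 // (negbTE ec) (negbTE cd).
Qed.

(** A short root [b] with positive product against the long root [a] has pairing 1 with it, so
    [b - a] is the reflection of [b] in [a]. *)
Lemma exists_short_sub a : a \in roots D -> ~~ shortD a ->
  exists2 b, shortD b & shortD (b - a).
Proof.
rewrite shortE => aR; rewrite aR /= => a2; have a2' := root_norm_ge2 aR.
have {a2}a2 : 2 < '[a, a] by rewrite lt_def a2.
have [b bS ba] := exists_short_form_neq0 aR; have bR := short_root bS.
have b2 := short_norm bS.
have p1 : pairing b a = 1.
  apply/eqP; rewrite eq_le pairing_le1 ?b2 //=; last first.
    by apply: contraTneq a2 => <-; rewrite b2 ltxx.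
  rewrite -[1]add0r; apply: int_lt_le1; rewrite ?rpred0 ?pairing_int //.
  by rewrite pairing_gt0.
by exists b => //; have := short_refl aR bS; rewrite p1 scale1r.
Qed.

(* A long root [a] is the difference of the short roots [b] and [b - a]; since
   [lambda] pairs to at most 1 with short roots, [b] and [a - b] are positive. *)
Lemma exists_short_below a : a \in roots D -> pairing lambda a = 1 ->
  exists b, [/\ shortD b, positive b & forall i : 'I_(rank D), co i b <= co i a].
Proof.
move=> aR la; have pa : positive a by rewrite pairing_gt0_positive // la ltr01.
have [aS|aL] := boolP (shortD a); first by exists a.
have [b bS cS] := exists_short_sub aR aL; have bR := short_root bS.
have {aL}a2 : 2 < '[a, a].
  by move: aL; rewrite shortE aR lt_def root_norm_ge2 // => ->.
have := form_pairing lambda aR; rewrite la mul1r => lan.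
have := alcove_geN1 hlambda (short_root cS).
have := alcove_le1 hlambda bR.
rewrite !pairing_short // !formE lan => h1 h2.
exists b; split=> //; first by apply: (alcove_positive hlambda) => //; lra.
have : positive (- (b - a)).
  apply: (alcove_positive hlambda); first by rewrite root_oppE short_root.
  rewrite !formE lan; lra.
by move=> /positiveP h i; have := h i; rewrite coN coD coN opprB subr_ge0.
Qed.

(** Descending by simple reflections keeps the root short, positive and supported in [J] until it is
    simple. *)
Lemma short_simple_exists (J : subD) a : shortD a -> positive a -> supported J a ->
  exists2 i, i \in J & shortD (alpha i).
Proof.
move=> aS; have aR := short_root aS; move: a aR aS.
apply: (@seq_ind_gt _ _ (roots D) (fun v => - ht v)) => a aR IH aS pa sa.
have [i iJ ai] := exists_form_gt0 (root_neq0 aR) sa pa.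
have iR := simple_root i.
have [aE|aDi] := eqVneq a (alpha i); first by exists i; rewrite -?aE.
apply: (IH _ (refl_root iR aR)).
- by rewrite ht_refl_simple ltrN2 gtrBl pairing_gt0.
- exact: short_refl.
- exact: positive_refl_simple.
- by rewrite supportedD ?supportedN ?supportedZ ?supported_simple.
Qed.

(** An acute expression forces (v, b) >= 2, while [lattice_norm_ge] for [v - b] gives (v, b) <= 1 +
    (lambda, b) <= 2; so all are equalities. *)
Lemma nearest_sub_largest (I : subD) b v : connected I ->
  shortD b -> supported I b -> dominant_on I b ->
  nearest v -> v != 0 -> supported I v -> dominant_on I v ->
  [/\ '[v, b] = 2, '[lambda, b] = 1 & nearest (v - b)].
Proof.
move=> cI bS sb db vN v0 sv dv; have [vL vE] := vN.
have bR := short_root bS; have b2 := short_norm bS.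
have [[|a s] [[sR vs] hs]] := nearest_root_sum sv vN.
  by rewrite vs big_nil eqxx in v0.
have [aR sa] := sR a (mem_head _ _); have [_ av] := hs a (mem_head _ _).
have pva : 2 <= pairing v a.
  rewrite pairingE (formC D v) ler_pdivlMr ?root_norm_gt0 //; lra.
have vb := le_trans pva (pairing_le_largest cI bS sb db dv aR sa).
have vbL : lattice (v - b) by apply/latticeD/latticeN/lattice_root.
have := lattice_norm_ge vbL; have := alcove_le1 hlambda bR.
rewrite pairing_short // !formE vE b2 (formC D b v) (formC D b lambda) => h1 h2.
have e1 : '[v, b] = 2 by lra.
have e2 : '[lambda, b] = 1 by lra.
split=> //; split=> //; rewrite !formE vE b2 (formC D b v) (formC D b lambda).
lra.
Qed.

End Nearest.
End NearestLatticePoints.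

(** * The cascade *)

Section Cascade.
Variables (R : realType) (V : vectType R) (D : rootSystem V).

Local Notation "'[ u , v ]" := (form D u v) (at level 0).
Local Notation alpha := (tnth (simple D)).
Local Notation subD := {set 'I_(rank D)}.
Local Notation shortD := (short (form D) (roots D)).
Local Notation pairing := (pairing D).
Local Notation positive := (positive D).
Local Notation supported := (@supported _ _ D).
Local Notation dominant_on := (@dominant_on _ _ D).
Local Notation lattice := (lattice D).
Local Notation beta1 := (beta1 D).

Lemma dynkin_edge_sym (S : subD) : symmetric (dynkin_edge S).
Proof.
move=> i j; rewrite /dynkin_edge (formC D (alpha j)) (eq_sym j).
by rewrite andbCA.
Qed.

Lemma dynkin_connect_sym (S : subD) : connect_sym (dynkin_edge S).
Proof. exact: sym_connect_sym (dynkin_edge_sym S). Qed.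

Lemma component_sub (S J : subD) : J \in components S -> J \subset S.
Proof.
case/imsetP=> i iS ->; apply/fintype.subsetP => j; rewrite finset.inE => ij.
have cl : closed (dynkin_edge S) (mem S).
  by apply: (intro_closed (dynkin_connect_sym S)) => x y /and3P[].
by rewrite -(closed_connect cl ij).
Qed.

Lemma component_connect (S J : subD) i : J \in components S -> i \in J ->
  J = [set j | connect (dynkin_edge S) i j]%SET.
Proof.
case/imsetP=> k kS ->; rewrite finset.inE => ki; apply/finset.setP => j.
by rewrite !finset.inE (same_connect (dynkin_connect_sym S) ki).
Qed.

Lemma component_eq (S J K : subD) i : J \in components S -> K \in components S ->
  i \in J -> i \in K -> J = K.
Proof.
by move=> JS KS iJ iK; rewrite (component_connect JS iJ) (component_connect KS iK).
Qed.

Lemma component_exists (S : subD) i : i \in S ->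
  exists2 J, J \in components S & i \in J.
Proof.
move=> iS; exists [set j | connect (dynkin_edge S) i j]%SET; first exact: imset_f.
by rewrite finset.inE connect0.
Qed.

Lemma component_orth (S J : subD) i j : J \in components S ->
  i \in J -> j \in S -> j \notin J -> '[alpha i, alpha j] = 0.
Proof.
move=> JS iJ jS jJ; apply/eqP; apply: contraNT jJ => ij.
rewrite (component_connect JS iJ) finset.inE; have [<-|iDj] := eqVneq i j.
  exact: connect0.
apply: connect1; rewrite /dynkin_edge jS iDj ij !andbT.
exact: (fintype.subsetP (component_sub JS)).
Qed.

Lemma component_connected (S J : subD) : J \in components S -> connected J.
Proof.
move=> JS T TJ /set0Pn[s sT] TDJ; apply: contrapT => h.
have TsubJ := fintype.subsetP TJ; have JsubS := fintype.subsetP (component_sub JS).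
have cl : closed (dynkin_edge S) (mem T).
  apply: (intro_closed (dynkin_connect_sym S)) => x y /and4P[xS yS xy fxy] xT.
  apply/negPn/negP => yT; apply: h; exists x, y; split=> //.
  apply/negPn/negP => yJ; move/negP: fxy; apply; apply/eqP.
  by apply: (component_orth JS) => //; apply: TsubJ.
move/negP: TDJ; apply; rewrite finset.eqEsubset TJ; apply/fintype.subsetP => j.
rewrite (component_connect JS (TsubJ _ sT)) finset.inE => sj.
by rewrite -(closed_connect cl sj).
Qed.

Definition perp (I : subD) : subD :=
  [set i in I | '[largest_short I, alpha i] == 0]%SET.

Lemma cascade_stepE I J : cascade_step I J =
  (J \in components (perp I)) && [exists i in J, shortD (alpha i)].
Proof. by []. Qed.

Lemma cascade_step_sub (I J : subD) : cascade_step I J -> J \subset perp I.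
Proof. by rewrite cascade_stepE => /andP[/component_sub]. Qed.

Lemma short_connected_step (I J : subD) : cascade_step I J -> short_connected J.
Proof.
rewrite cascade_stepE => /andP[JI /exists_inP[i iJ ai]]; split.
  exact: component_connected JI.
by exists (alpha i); split=> //; apply: supported_simple.
Qed.

Lemma cascade_step_proper (I J : subD) : short_connected I -> cascade_step I J ->
  J \proper I.
Proof.
move=> cI /cascade_step_sub JI; apply: sub_proper_trans JI _.
apply/properP; split; first by apply/fintype.subsetP => i; rewrite finset.inE => /andP[].
have [bS sb db] := largest_shortP cI; have bR := short_root bS.
have [i iI bi] := exists_form_gt0 (root_neq0 bR) sb (dominant_root_positive bR sb db).
by exists i => //; rewrite finset.inE iI /= gt_eqF.
Qed.

(* [cascade_chain n I xi]: [I] is obtained after [n] steps of the cascade, and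
   [xi] is the sum of the largest short roots met on the way, that of [I]
   included. *)
Inductive cascade_chain : nat -> subD -> V -> Prop :=
| CascadeChain0 : cascade_chain 0 [set: 'I_(rank D)]%SET beta1
| CascadeChainS n I J xi : cascade_chain n I xi -> cascade_step I J ->
    cascade_chain n.+1 J (xi + largest_short J).

Lemma cascade_chain_connected n I xi : cascade_chain n I xi -> short_connected I.
Proof.
case=> [|m J K x _ /short_connected_step //]; exact: short_connectedT.
Qed.

Lemma cascade_chain_subset n I xi : cascade_chain n I xi -> cascade_subset I.
Proof.
elim=> [|m J K x _ IH JK]; first exact: connect0.
exact: connect_trans IH (connect1 JK).
Qed.

Lemma cascade_subsetP I : cascade_subset I -> exists n xi, cascade_chain n I xi.
Proof.
case/connectP=> p; elim/last_ind: p I => [|p J IH] I /=.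
  by move=> _ ->; exists 0%N, beta1; apply: CascadeChain0.
rewrite rcons_path last_rcons => /andP[pP JP] ->.
have [n [xi h]] := IH _ pP erefl.
by exists n.+1, (xi + largest_short J); apply: CascadeChainS h JP.
Qed.

Lemma cascade_chain_nonempty n I xi : cascade_chain n I xi -> exists i, i \in I.
Proof.
move=> /cascade_chain_connected cI; have [bS sb db] := largest_shortP cI.
have bR := short_root bS.
have [i iI _] := exists_form_gt0 (root_neq0 bR) sb (dominant_root_positive bR sb db).
by exists i.
Qed.

(** The parents share [i] and agree by induction, and two components of the same set that meet
    coincide. *)
Lemma cascade_chain_eq n I J xi zeta i : cascade_chain n I xi ->
  cascade_chain n J zeta -> i \in I -> i \in J -> I = J.
Proof.
elim: n I J xi zeta => [|n IH] I J xi zeta.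
  by move=> h1 h2; inversion h1; inversion h2.
move=> h1 h2 iI iJ; inversion h1 as [|m I' K1 x1 c1 s1]; subst.
inversion h2 as [|m J' K2 x2 c2 s2]; subst.
have sub K L : cascade_step K L -> i \in L -> i \in K.
  by move=> /cascade_step_sub/fintype.subsetP s /s; rewrite finset.inE => /andP[].
have E := IH _ _ _ _ c1 c2 (sub _ _ s1 iI) (sub _ _ s2 iJ); subst J'.
move: s1 s2; rewrite !cascade_stepE => /andP[s1 _] /andP[s2 _].
exact: component_eq s1 s2 iI iJ.
Qed.

Lemma cascade_chain_ancestor n m I xi : cascade_chain n I xi -> (m < n)%N ->
  exists J zeta, cascade_chain m J zeta /\ I \proper J.
Proof.
elim=> // k J K x c IH s; rewrite ltnS leq_eqVlt => /orP[/eqP ->|mk].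
  exists J, x; split=> //.
  exact: cascade_step_proper (cascade_chain_connected c) s.
have [L [z [cL JL]]] := IH mk; exists L, z; split=> //.
apply: proper_trans JL.
exact: cascade_step_proper (cascade_chain_connected c) s.
Qed.

(** An occurrence at a larger depth would have an ancestor at the smaller depth strictly containing
    [I], against [cascade_chain_eq]. *)
Lemma cascade_chain_depth n m I xi zeta : cascade_chain n I xi ->
  cascade_chain m I zeta -> n = m.
Proof.
wlog nm : n m xi zeta / (n <= m)%N.
  by move=> W c1 c2; case/orP: (leq_total n m) => h;
    [exact: W h c1 c2 | symmetry; exact: W h c2 c1].
move=> c1 c2; apply/eqP; rewrite eqn_leq nm leqNgt; apply/negP => lt.
have [J [z [cJ IJ]]] := cascade_chain_ancestor c2 lt.
have [i iI] := cascade_chain_nonempty c1.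
have iJ : i \in J := fintype.subsetP (proper_sub IJ) _ iI.
by rewrite (cascade_chain_eq c1 cJ iI iJ) fintype.properxx in IJ.
Qed.

(** Predecessors are unique: a second parent of [J] has the same depth as [I] and meets it in
    [J]. *)
Lemma cascade_chain_pred n I J xi b : cascade_chain n I xi -> cascade_step I J ->
  cascade_pred D b (largest_short J) -> b = largest_short I.
Proof.
move=> c s [I' [J' [[sI' sJ'] -> EJ JI']]].
have cJ := CascadeChainS c s.
have [m' [z' cJ']] := cascade_subsetP sJ'.
have JE := largest_short_inj (cascade_chain_connected cJ) (cascade_chain_connected cJ') EJ.
have [m [z cI']] := cascade_subsetP sI'.
have s' : cascade_step I' J.
  rewrite JE cascade_stepE JI' -JE /=.
  by have := s; rewrite cascade_stepE => /andP[].
have [E] := cascade_chain_depth cJ (CascadeChainS cI' s'); subst m.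
have [i iJ] := cascade_chain_nonempty cJ.
have sub K : cascade_step K J -> i \in K.
  move=> /cascade_step_sub/fintype.subsetP/(_ i iJ).
  by rewrite finset.inE => /andP[].
by rewrite (cascade_chain_eq c cI' (sub _ s) (sub _ s')).
Qed.

Lemma cascade_pred_beta1 b : ~ cascade_pred D b beta1.
Proof.
move=> [I [J [[sI sJ] _ EJ JI]]].
have [m [z cJ]] := cascade_subsetP sJ; have [n [y cI]] := cascade_subsetP sI.
have JT := largest_short_inj (short_connectedT D) (cascade_chain_connected cJ) EJ.
have [bS sb db] := largest_shortP (cascade_chain_connected cI).
have bR := short_root bS.
have [i iI bi] := exists_form_gt0 (root_neq0 bR) sb (dominant_root_positive bR sb db).
have := fintype.subsetP (component_sub JI) i; rewrite -JT !finset.inE => /(_ isT).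
by rewrite iI (gt_eqF bi).
Qed.

Definition lower_cascade (b : V) : set V := [set b' | cascade D b' /\ cascade_le D b' b].

Lemma lower_cascade_beta1 : lower_cascade beta1 = [set beta1].
Proof.
apply/seteqP; split=> b /= => [[_ h]|->].
  inversion h as [|b' b'' h1 h2]; subst => //.
  by have := cascade_pred_beta1 h2.
split; last exact: cascade_le_refl.
exists [set: 'I_(rank D)]%SET => //; exact: connect0.
Qed.

Lemma lower_cascade_step n I J xi : cascade_chain n I xi -> cascade_step I J ->
  lower_cascade (largest_short J) =
    largest_short J |` lower_cascade (largest_short I).
Proof.
move=> c s; have cJ := CascadeChainS c s; apply/seteqP; split=> b /=.
  move=> [bC h]; inversion h as [|b' b'' h1 h2]; subst; first by left.
  by right; split=> //; rewrite -(cascade_chain_pred c s h2).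
have sJ := cascade_chain_subset cJ.
case=> [->|[bC h]]; first by split; [exists J | apply: cascade_le_refl].
split=> //; apply: cascade_le_step h _; exists I, J; split=> //.
- split=> //; exact: cascade_chain_subset c.
- by have := s; rewrite cascade_stepE => /andP[].
Qed.

(** The depth bound serves to show that the root added by the next step is not among the lower
    ones. *)
Lemma lower_cascade_chain n I xi b : cascade_chain n I xi ->
  lower_cascade (largest_short I) b ->
  exists m J zeta, [/\ (m <= n)%N, cascade_chain m J zeta & b = largest_short J].
Proof.
elim=> [|m J K x c IH s].
  rewrite lower_cascade_beta1 => ->.
  by exists 0%N, [set: 'I_(rank D)]%SET, beta1; split=> //; apply: CascadeChain0.
rewrite (lower_cascade_step c s) => -[->|/IH[m' [J' [z [mm h1 h2]]]]].
  by exists m.+1, K, (x + largest_short K); split=> //; apply: CascadeChainS c s.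
by exists m', J', z; split=> //; apply: leqW.
Qed.

(** Finiteness of the lower set is carried along so that the finitely supported sum splits at each
    step. *)
Lemma cascade_chain_sum n I xi : cascade_chain n I xi ->
  finite_set (lower_cascade (largest_short I)) /\
  cascade_sum D (largest_short I) = xi.
Proof.
rewrite /cascade_sum; elim=> [|m J K x c [fin IH] s].
  rewrite -/(lower_cascade _) lower_cascade_beta1; split; first exact: finite_set1.
  by rewrite fsbig_set1.
rewrite -/(lower_cascade _) (lower_cascade_step c s); split.
  by rewrite finite_setU; split=> //; apply: finite_set1.
rewrite fsbigU0 ?fsbig_set1 //; first by rewrite IH addrC.
(* Were [largest_short K] already a lower root, [K] would occur both at depth [m.+1] and at depth at
   most [m]. *)
move=> b /= [-> h]; have cK := CascadeChainS c s.
have [m' [L [z [mm cL E]]]] := lower_cascade_chain c h.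
have KL := largest_short_inj (cascade_chain_connected cK) (cascade_chain_connected cL) E.
rewrite -KL in cL.
by have := cascade_chain_depth cK cL => mE; rewrite -mE ltnn in mm.
Qed.

Lemma cascade_chain_lattice n I xi : cascade_chain n I xi ->
  [/\ lattice xi, positive xi & xi != 0].
Proof.
have ls (K : subD) : short_connected K -> [/\ lattice (largest_short K),
    positive (largest_short K) & largest_short K != 0].
  move=> cK; have [bS sb db] := largest_shortP cK; have bR := short_root bS.
  split; [exact: lattice_root bR | exact: dominant_root_positive bR sb db |].
  exact: root_neq0 bR.
elim=> [|m J K x c [xL xP x0] s]; first exact: ls (short_connectedT D).
have [bL bP b0] := ls _ (short_connected_step s); split; first exact: latticeD.
  by apply/positiveP => i; rewrite coD addr_ge0 ?(positiveP _ _ xP) ?(positiveP _ _ bP).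
have [i xi'] := neq0_co D x0.
suff : 0 < co i (x + largest_short K) by apply: contraTneq => ->; rewrite co0 ltxx.
by rewrite coD ltr_pwDl ?(positiveP _ _ bP) // lt_def xi' (positiveP _ _ xP).
Qed.

Section NearestChain.
Variables (lambda : V) (hlambda : fundamental_alcove D lambda).

Local Notation nearest := (nearest D lambda).

(* By the nonnegativity of coefficients, two terms of [nearest_root_sum] in
   different components would give [(lambda, b) >= 2]. *)
Lemma nearest_component (I : subD) v : short_connected I ->
  '[lambda, largest_short I] = 1 -> '[v, largest_short I] = 0 ->
  nearest v -> v != 0 -> supported I v ->
  exists2 J, cascade_step I J & supported J v.
Proof.
move=> cI lb vb vN v0 sv; have [bS sb db] := largest_shortP cI.
have bR := short_root bS; set b := largest_short I in lb vb bS sb db bR.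
have [[|a s] [[sR vs] hs]] := nearest_root_sum hlambda sv vN.
  by rewrite vs big_nil eqxx in v0.
have pos c : c \in a :: s -> positive c.
  move=> cs; have [cR _] := sR c cs; apply: (pairing_gt0_positive hlambda cR).
  by have [-> _] := hs c cs; rewrite ltr01.
have bperp c : c \in a :: s -> '[c, b] = 0.
  move=> cs; apply/eqP; have := vb; rewrite vs form_suml big_seq => /eqP.
  rewrite psumr_eq0 => [/allP/(_ c cs)/implyP/(_ cs) //|d ds].
  have [dR sd] := sR d ds; rewrite formC; apply: dominant_on_form db sd _.
  exact: pos.
have sperp c : c \in a :: s -> supported (perp I) c.
  move=> cs; have [cR sc] := sR c cs; apply/supportedP => i; rewrite finset.inE.
  have [iI /= bi|iI _] := boolP (i \in I); last exact: (supportedP _ _ sc).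
  have := bperp c cs; rewrite formC (form_supported _ sc) => /eqP.
  rewrite psumr_eq0 => [/allP/(_ i)|j jI]; last first.
    by rewrite mulr_ge0 ?db // (positiveP _ _ (pos c cs)).
  rewrite mem_index_enum => /(_ isT)/implyP/(_ iI); rewrite mulf_eq0 (negbTE bi) orbF.
  by move/eqP.
have comp c : c \in a :: s -> exists2 J, J \in components (perp I) & supported J c.
  move=> cs; have [cR _] := sR c cs; have [k ck] := neq0_co D (root_neq0 cR).
  have kP : k \in perp I.
    by apply: contraNT ck => kP; rewrite (supportedP _ _ (sperp c cs)).
  have [J JP kJ] := component_exists kP; exists J => //.
  have orth i j := @component_orth _ _ i j JP.
  have [//|sc] := root_support_split (component_sub JP) orth cR (sperp c cs).
  by move: ck; rewrite (supportedP _ _ sc) ?eqxx // finset.inE kJ.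
have [J JP sJa] := comp a (mem_head _ _).
have ge0 i : 0 <= '[lambda, alpha i] by apply: alcove_simple.
have sJ (c : V) : c \in a :: s -> supported J c.
  move=> cs; have [K KP sKc] := comp c cs.
  have [JK|JK] := eqVneq J K; first by rewrite JK.
  have [aR sa] := sR a (mem_head _ _); have [cR sc] := sR c cs.
  have [la _] := hs a (mem_head _ _); have [lc _] := hs c cs.
  (* The coroots of [a] and [c] have disjoint supports, so the coefficientwise bound by [b] holds
     for their sum. *)
  suff : pairing lambda a + pairing lambda c <= '[lambda, b].
    by rewrite la lc lb; lra.
  rewrite !pairing_co form_co -big_split /= ler_sum // => i _.
  rewrite -mulrDl ler_wpM2r //.
  have le d : d \in a :: s -> co i (coroot (form D) d) <= co i b.
    move=> ds; have [dR sd] := sR d ds.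
    exact: (coroot_le_dominant_short (proj1 cI)).
  have [iJ|iJ] := boolP (i \in J).
    rewrite [co i (coroot _ c)]coZ (supportedP _ _ sKc) ?mulr0 ?addr0 ?le //.
      exact: mem_head.
    by apply: contra JK => iK; rewrite (component_eq JP KP iJ iK).
  rewrite [co i (coroot _ a)]coZ (supportedP _ _ sJa) // mulr0 add0r.
  exact: le.
exists J; last by rewrite vs; apply: supported_sum => c; apply: sJ.
rewrite cascade_stepE JP /=; apply/exists_inP.
have [aR _] := sR a (mem_head _ _); have [la _] := hs a (mem_head _ _).
(* A cascade step requires a short simple root in [J]; it is found below a short root that lies
   coefficientwise below [a]. *)
have [d [dS pd da]] := exists_short_below hlambda aR la.
apply: (short_simple_exists dS pd); apply/supportedP => i iJ.
apply/eqP; rewrite eq_le (positiveP _ _ pd) andbT.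
by apply: le_trans (da i) _; rewrite (supportedP _ _ sJa).
Qed.

(** Here [xi] is what was collected above [I], and [v] stands for the contribution of [I] and its
    descendants. Induct on the size of [I]: after subtracting [largest_short I] the rest lies in one
    component, where it is still dominant by orthogonality. *)
Lemma nearest_cascade_chain n (I : subD) xi v :
  cascade_chain n I (xi + largest_short I) ->
  nearest v -> v != 0 -> supported I v -> dominant_on I v ->
  exists m J, cascade_chain m J (xi + v).
Proof.
have [k] := ubnP #|I|; elim: k n I xi v => // k IH n I xi v.
rewrite ltnS => Ik c vN v0 sv dv; have cI := cascade_chain_connected c.
have [bS sb db] := largest_shortP cI; have bR := short_root bS.
have [vb lb wN] := nearest_sub_largest hlambda (proj1 cI) bS sb db vN v0 sv dv.
have [vE|vDb] := eqVneq v (largest_short I); first by exists n, I; rewrite vE.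
set w := v - largest_short I in wN.
have w0 : w != 0 by rewrite subr_eq0.
have wb : '[w, largest_short I] = 0.
  by rewrite /w !formE vb (short_norm bS) subrr.
have sw : supported I w by rewrite supportedD // supportedN.
have [J IJ sJ] := nearest_component cI lb wb wN w0 sw.
have Jk : (#|J| < k)%N.
  exact: leq_trans (proper_card (cascade_step_proper cI IJ)) Ik.
have dw : dominant_on J w.
  move=> i iJ; have := fintype.subsetP (cascade_step_sub IJ) i iJ.
  by rewrite finset.inE /w !formE => /andP[iI /eqP ->]; rewrite subr0 dv.
have [m [K h]] := IH _ J _ w Jk (CascadeChainS c IJ) wN w0 sJ dw.
exists m, K; have -> // : xi + v = xi + largest_short I + w.
by rewrite -addrA /w [_ + (v - _)]addrC subrK.
Qed.

(** The cascade enters the remaining proof only through this description. *)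
Lemma summation_setP xi : summation_set D lambda xi <->
  [/\ nearest xi, dominant D xi & xi != 0].
Proof.
split=> [[[b [I sI <-] ->] dx xN]|[xN dx x0]].
  have [n [z c]] := cascade_subsetP sI; have [_ E] := cascade_chain_sum c.
  rewrite E in dx xN *; have [zL _ z0] := cascade_chain_lattice c.
  by split.
have := @nearest_cascade_chain 0 [set: 'I_(rank D)]%SET 0 xi.
rewrite !add0r => /(_ (CascadeChain0) xN x0 (supportedT D _)) [].
  by move=> i _; move/dominantE: dx; apply.
move=> m [J c]; split=> //; last by case: xN.
have [_ E] := cascade_chain_sum c; exists (largest_short J) => //.
exists J => //=; exact: cascade_chain_subset c.
Qed.

End NearestChain.
End Cascade.

(** * Words in the Coxeter generators and crossed hyperplanes *)

Section AffineWords.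
Variables (R : realType) (V : vectType R) (D : rootSystem V).

Local Notation "'[ u , v ]" := (form D u v) (at level 0).
Local Notation alpha := (tnth (simple D)).
Local Notation pairing := (pairing D).
Local Notation positive := (positive D).
Local Notation lattice := (lattice D).
Local Notation beta1 := (beta1 D).
Local Notation gen := (@coxeter_generator _ _ D).
Local Notation ev := (@word_eval _ _ D).
Local Notation aref := (affine_reflection (form D)).

(** * Affine isometries, reflections and words *)

Definition lin (w : V -> V) (x : V) : V := w x - w 0.

Lemma linE w x : w x = w 0 + lin w x.
Proof. by rewrite addrC subrK. Qed.

(** The lattice condition on [w 0] makes the crossing numbers integers. *)
Definition affine_isometry (w : V -> V) : Prop :=
  [/\ forall x y, lin w (x + y) = lin w x + lin w y,
      forall c x, lin w (c *: x) = c *: lin w x,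
      forall x y, '[lin w x, lin w y] = '[x, y],
      forall a, a \in roots D -> lin w a \in roots D &
      lattice (w 0)].

Lemma linN w x : affine_isometry w -> lin w (- x) = - lin w x.
Proof. by case=> _ h _ _ _; rewrite -scaleN1r h scaleN1r. Qed.

Lemma linB w x y : affine_isometry w -> lin w (x - y) = lin w x - lin w y.
Proof. by move=> wI; case: (wI) => h _ _ _ _; rewrite h linN. Qed.

Lemma affine_isometry_sub w x y : affine_isometry w -> w x - w y = lin w (x - y).
Proof. by move=> wI; rewrite linB // /lin opprB addrA subrK. Qed.

Lemma lin_comp w u x : affine_isometry w -> lin (w \o u) x = lin w (lin u x).
Proof. by move=> wI; rewrite /lin /= affine_isometry_sub. Qed.

Lemma pairing_lin w x a : affine_isometry w -> pairing (lin w x) (lin w a) = pairing x a.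
Proof. by case=> _ _ h _ _; rewrite !pairingE !h. Qed.

Lemma lin_inj w : affine_isometry w -> injective (lin w).
Proof.
move=> wI x y /eqP; rewrite -subr_eq0 -linB // => /eqP h.
apply/eqP; rewrite -subr_eq0 -(form_eq0 D).
by case: (wI) => _ _ iso _ _; rewrite -iso h form0l.
Qed.

Lemma lattice_lin w v : affine_isometry w -> lattice v -> lattice (lin w v).
Proof.
move=> wI vL i; rewrite (coE D v); case: (wI) => hD hZ _ hR _.
have -> : lin w (\sum_j co j v *: alpha j) = \sum_j co j v *: lin w (alpha j).
  have h0 : lin w 0 = 0 by rewrite /lin subrr.
  by rewrite (big_morph _ hD h0); apply: eq_bigr => j _; rewrite hZ.
rewrite co_sum rpred_sum // => j _; rewrite coZ rpredM //.
exact/co_int/hR/simple_root.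
Qed.

Lemma affine_isometry_comp w u : affine_isometry w -> affine_isometry u ->
  affine_isometry (w \o u).
Proof.
move=> wI uI; have E := fun x => lin_comp u x wI.
case: (wI) (uI) => [w1 w2 w3 w4 w5] [u1 u2 u3 u4 u5]; split.
- by move=> x y; rewrite !E u1 w1.
- by move=> c x; rewrite !E u2 w2.
- by move=> x y; rewrite !E w3 u3.
- by move=> a aR; rewrite E w4 // u4.
- by rewrite /= linE; apply: latticeD => //; apply: lattice_lin.
Qed.

Lemma arefE a c x : aref a c x = x - (pairing x a - c) *: a.
Proof. by []. Qed.

Lemma aref0 a c : aref a c 0 = c *: a.
Proof. by rewrite arefE pairing0l !sub0r scaleNr opprK. Qed.

Lemma lin_aref a c x : lin (aref a c) x = x - pairing x a *: a.
Proof. by rewrite /lin aref0 arefE scalerBl opprB -addrA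
  [X in _ + X]addrAC subrr add0r. Qed.

Lemma arefN a c : aref (- a) (- c) = aref a c.
Proof.
by apply: funext => x; rewrite !arefE pairingNr -opprD scaleNr scalerN opprK.
Qed.

Lemma arefK a c : a \in roots D -> involutive (aref a c).
Proof.
move=> aR x; rewrite !arefE pairingBl pairingZl pairing_self //.
rewrite -addrA -opprD -scalerDl.
have -> : forall p : R, p - c + (p - (p - c) * 2 - c) = 0 by move=> p; ring.
by rewrite scale0r subr0.
Qed.

Lemma aref_fix a c x : a \in roots D -> (aref a c x == x) = (pairing x a == c).
Proof.
move=> aR; rewrite arefE -subr_eq0 addrAC subrr sub0r oppr_eq0 scaler_eq0.
by rewrite (negbTE (root_neq0 aR)) orbF subr_eq0.
Qed.

Lemma affine_isometry_aref a c : a \in roots D -> c \is a Num.int ->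
  affine_isometry (aref a c).
Proof.
move=> aR cZ; split.
- by move=> x y; rewrite !lin_aref pairingDl scalerDl opprD addrACA.
- by move=> d x; rewrite !lin_aref pairingZl -scalerA scalerBr.
- move=> x y; rewrite !lin_aref !formE (formC D a y) !pairingE.
  by have := root_norm_gt0 aR => n0; field; rewrite gt_eqF.
- by move=> b bR; rewrite lin_aref refl_root.
- by rewrite aref0; apply: latticeZ => //; apply: lattice_root.
Qed.

Lemma aref_conj w a c : affine_isometry w ->
  w \o aref a c = aref (lin w a) (c + pairing (w 0) (lin w a)) \o w.
Proof.
move=> wI; apply: funext => x /=; rewrite !arefE.
rewrite [LHS]linE linB //; case: (wI) => _ -> _ _ _.
rewrite addrA -linE; congr (_ - _ *: _).
rewrite [in RHS](linE w x) pairingDl pairing_lin //; ring.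
Qed.

(* Every Coxeter generator is the reflection in the wall
   [pairing x (wall_root o) = wall_level o] of the alcove. *)
Definition wall_root (o : option 'I_(rank D)) : V :=
  if o is Some i then alpha i else - beta1.

(** The signs for [s0] are such that the alcove always lies on the side where the pairing is at
    least the level. *)
Definition wall_level (o : option 'I_(rank D)) : R :=
  if o is Some _ then 0 else -1.

Lemma genE o : gen o = aref (wall_root o) (wall_level o).
Proof. by case: o => [i|] //=; rewrite arefN. Qed.

Lemma wall_root_root o : wall_root o \in roots D.
Proof. by case: o => [i|]; [apply: simple_root | rewrite root_oppE root_beta1]. Qed.

Lemma affine_isometry_gen o : affine_isometry (gen o).
Proof.
rewrite genE; apply: affine_isometry_aref; first exact: wall_root_root.
by case: o => [i|] /=; rewrite ?rpredN ?rpred0 ?rpred1.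
Qed.

Lemma genK o : involutive (gen o).
Proof. by rewrite genE; apply/arefK/wall_root_root. Qed.

Lemma ev_cons o s : ev (o :: s) = gen o \o ev s.
Proof. by []. Qed.

Lemma ev_cat s t : ev (s ++ t) = ev s \o ev t.
Proof. by elim: s => //= o s ->. Qed.

Lemma ev_rev s : cancel (ev s) (ev (rev s)).
Proof.
by elim: s => // o s IH x; rewrite rev_cons -cats1 ev_cat /= genK IH.
Qed.

Lemma affine_isometry_ev s : affine_isometry (ev s).
Proof.
elim: s => [|o s IH].
  have E x : lin (ev [::]) x = x by rewrite /lin /= subr0.
  by split=> *; rewrite /= ?E //; apply: lattice0.
by rewrite ev_cons; apply: affine_isometry_comp => //; apply: affine_isometry_gen.
Qed.

Definition words : set (V -> V) := [set w | exists s, ev s = w].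

Lemma words_isometry w : words w -> affine_isometry w.
Proof. by case=> s <-; apply: affine_isometry_ev. Qed.

Lemma words_comp w u : words w -> words u -> words (w \o u).
Proof. by move=> [s <-] [t <-]; exists (s ++ t); rewrite ev_cat. Qed.

Lemma words_gen o : words (gen o).
Proof. by exists [:: o]. Qed.

Lemma words_id : words idfun.
Proof. by exists [::]. Qed.

Lemma words_inv w : words w -> exists u, [/\ words u, cancel w u & cancel u w].
Proof.
move=> [s <-]; exists (ev (rev s)); split; first by exists (rev s).
  exact: ev_rev.
by move=> x; have := ev_rev (rev s) x; rewrite revK.
Qed.

Lemma words_root_preim w a : words w -> a \in roots D ->
  exists2 b, b \in roots D & lin w b = a.
Proof.
move=> wW aR; have [u [uW wu uw]] := words_inv wW.
have uI := words_isometry uW; have wI := words_isometry wW.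
exists (lin u a); first by case: uI => _ _ _ h _; apply: h.
rewrite -(lin_comp u a wI) (_ : w \o u = idfun) ?/lin ?subr0 //.
by apply: funext => x /=; rewrite uw.
Qed.

(* [pairing x a] lies between [alcove_floor a] and [alcove_floor a + 1] for [x]
   in the alcove. *)
Definition alcove_floor (a : V) : R := if positive a then 0 else -1.

Lemma alcove_floorN a : a \in roots D -> alcove_floor (- a) = -1 - alcove_floor a.
Proof. by move=> aR; rewrite /alcove_floor positive_opp //; case: (positive a) => /=; ring. Qed.

Lemma alcove_floor_int a : alcove_floor a \is a Num.int.
Proof. by rewrite /alcove_floor; case: ifP => _; rewrite ?rpredN ?rpred0 ?rpred1. Qed.

Lemma alcove_floor_wall o : alcove_floor (wall_root o) = wall_level o.
Proof.
rewrite /alcove_floor; case: o => [i|] /=; first by rewrite positive_simple.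
by rewrite positive_opp ?root_beta1 // positive_beta1.
Qed.

(* The signed number of hyperplanes orthogonal to [lin w a] between the alcove
   and its image under [w]. *)
Definition crossing (w : V -> V) (a : V) : R :=
  pairing (w 0) (lin w a) + alcove_floor a - alcove_floor (lin w a).

(** A cocycle identity: the hyperplanes between the alcove and its image are counted with sign in
    two stages. *)
Lemma crossing_comp w u a : affine_isometry w ->
  crossing (w \o u) a = crossing w (lin u a) + crossing u a.
Proof.
move=> wI; rewrite /crossing (lin_comp u a wI) /= (linE w (u 0)).
rewrite pairingDl pairing_lin //; ring.
Qed.

Lemma crossingN w a : affine_isometry w -> a \in roots D ->
  crossing w (- a) = - crossing w a.
Proof.
move=> wI aR; rewrite /crossing linN // pairingNr !alcove_floorN //; last first.
  by case: wI => _ _ _ h _; apply: h.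
ring.
Qed.

Lemma crossing_int w a : affine_isometry w -> a \in roots D ->
  crossing w a \is a Num.int.
Proof.
case=> _ _ _ hR hL aR; rewrite rpredB ?rpredD ?alcove_floor_int //.
by rewrite pairing_lattice // hR.
Qed.

Lemma crossing_id a : crossing idfun a = 0.
Proof. by rewrite /crossing /lin /= subr0 pairing0l; ring. Qed.

Lemma pairing_refl_self a b : a \in roots D -> b \in roots D ->
  pairing a (b - pairing b a *: a) = - pairing a b.
Proof.
move=> aR bR; rewrite [LHS]pairingE refl_norm // !formE [in RHS]pairingE.
rewrite (formC D a b) (form_pairing b aR).
by have := root_norm_gt0 bR => n0; field; rewrite gt_eqF.
Qed.

Lemma crossing_aref a c b : a \in roots D -> b \in roots D ->
  crossing (aref a c) b = - (c * pairing a b) + alcove_floor b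
    - alcove_floor (b - pairing b a *: a).
Proof.
by move=> aR bR; rewrite /crossing lin_aref aref0 pairingZl pairing_refl_self // mulrN.
Qed.

Lemma alcove_floor_refl_simple i a : a \in roots D -> a != alpha i ->
  a != - alpha i ->
  alcove_floor (a - pairing a (alpha i) *: alpha i) = alcove_floor a.
Proof.
move=> aR ai aNi; have iR := simple_root i; have [p|p] := root_sign aR.
  by rewrite /alcove_floor p positive_refl_simple.
have naR : - a \in roots D by rewrite root_oppE.
have := @positive_refl_simple _ _ _ i _ naR p; rewrite eqr_oppLR aNi => /(_ isT).
have -> : - a - pairing (- a) (alpha i) *: alpha i =
    - (a - pairing a (alpha i) *: alpha i).
  by rewrite pairingNl scaleNr opprD.
rewrite positive_opp ?refl_root // /alcove_floor => /negbTE ->.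
by move: p; rewrite positive_opp // => /negbTE ->.
Qed.

(** If (beta1, c) > 0 and [c] is not [beta1], the pairing is 1, [c] is positive, and its reflection
    is negative, having a negative product with the dominant [beta1]. Negation gives the opposite
    case. *)
Lemma alcove_floor_refl_beta1 a : a \in roots D -> a != beta1 -> a != - beta1 ->
  alcove_floor (a - pairing a beta1 *: beta1) = alcove_floor a - pairing beta1 a.
Proof.
have pos c : c \in roots D -> 0 < '[beta1, c] -> positive c.
  apply: (@dominant_positive _ _ _ [set: 'I_(rank D)]%SET); last exact: supportedT.
  by move=> i _; apply: dominant_beta1.
have bR := root_beta1 D; have b2 := short_norm (short_beta1 D).
have H c : c \in roots D -> c != beta1 -> 0 < '[beta1, c] ->
    [/\ pairing beta1 c = 1, alcove_floor c = 0 &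
      alcove_floor (c - pairing c beta1 *: beta1) = -1].
  move=> cR cb c0; have rR := refl_root bR cR; split.
  - apply/eqP; rewrite eq_le pairing_le1 ?b2 ?root_norm_ge2 1?eq_sym //=.
    by rewrite -[1]add0r int_lt_le1 ?rpred0 ?pairing_int // pairing_gt0.
  - by rewrite /alcove_floor pos.
  - rewrite -[c - _]opprK alcove_floorN ?root_oppE // /alcove_floor pos ?subr0 //.
      by rewrite root_oppE.
    by move: c0; rewrite !formE (formC D beta1 c) pairing_short ?short_beta1 // b2; lra.
move=> aR ab aNb; have [h|h|h] := ltgtP 0 '[beta1, a].
- by have [-> -> ->] := H a aR ab h; rewrite sub0r.
- have naR : - a \in roots D by rewrite root_oppE.
  have [||h1 h2 h3] := H (- a) naR; rewrite ?eqr_oppLR ?formNr ?oppr_gt0 //.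
  move: h1 h2 h3; rewrite pairingNr pairingNl scaleNr -opprD !alcove_floorN ?refl_root //.
  lra.
- rewrite (_ : pairing a beta1 = 0) ?scale0r ?subr0; last first.
    by rewrite pairing_short ?short_beta1 // formC -h.
  rewrite (_ : pairing beta1 a = 0) ?subr0 //.
  by apply/eqP; rewrite pairing_eq0 // -h.
Qed.

Lemma crossing_gen_wall o : crossing (gen o) (wall_root o) = 1.
Proof.
have oR := wall_root_root o; rewrite genE crossing_aref // !pairing_self //.
rewrite scaler_nat mulr2n opprD addNKr alcove_floorN // alcove_floor_wall.
by case: o {oR} => [i|] /=; ring.
Qed.

(** A generator crosses no hyperplane but its own wall. For [s0] the translation part is cancelled
    by the change of [alcove_floor]. *)
Lemma crossing_gen_neq o a : a \in roots D -> a != wall_root o ->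
  a != - wall_root o -> crossing (gen o) a = 0.
Proof.
move=> aR ao aNo; rewrite genE crossing_aref ?wall_root_root //.
case: o ao aNo => [i|] /= ao aNo.
  rewrite alcove_floor_refl_simple //; ring.
rewrite pairingNr pairingNl scaleNr scalerN opprK alcove_floor_refl_beta1 //.
  by ring.
by rewrite -[beta1]opprK.
Qed.

Definition posroots : seq V := [seq a <- undup (roots D) | positive a].

Lemma mem_posroots a : (a \in posroots) = (a \in roots D) && positive a.
Proof. by rewrite mem_filter mem_undup andbC. Qed.

Lemma posroots_uniq : uniq posroots.
Proof. by rewrite filter_uniq // undup_uniq. Qed.

Lemma posroots_root a : a \in posroots -> a \in roots D.
Proof. by rewrite mem_posroots => /andP[]. Qed.

Lemma posroots_opp a b : a \in posroots -> b \in posroots -> a != - b.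
Proof.
rewrite !mem_posroots => /andP[aR pa] /andP[bR pb]; apply: contraTneq pa => ->.
by rewrite positive_opp // pb.
Qed.

(** The number of hyperplanes separating the alcove from its image under [w], one root being taken
    from each opposite pair. *)
Definition len (w : V -> V) : R := \sum_(a <- posroots) `|crossing w a|.

(** By the cocycle identity only the pair [a], [- a], sent to the wall root and its negative,
    changes its crossing number. *)
Lemma len_gen o w a : words w -> a \in roots D -> lin w a = wall_root o ->
  len (gen o \o w) = len w - `|crossing w a| + `|crossing w a + 1|.
Proof.
move=> wW aR wa; have wI := words_isometry wW; have oI := affine_isometry_gen o.
have [c cP ca] : exists2 c, c \in posroots & c = a \/ c = - a.
  have [p|p] := root_sign aR; [exists a | exists (- a)]; rewrite ?mem_posroots.
  - by rewrite aR p.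
  - by left.
  - by rewrite root_oppE aR p.
  - by right.
have cR := posroots_root cP.
rewrite /len (bigD1_seq c) ?posroots_uniq //= [in RHS](bigD1_seq c) ?posroots_uniq //=.
have -> : forall x y z t : R, x + y - z + t = (x - z + t) + y by move=> *; ring.
congr (_ + _).
  rewrite crossing_comp //; case: ca => ->.
    by rewrite wa crossing_gen_wall subrr add0r addrC.
  rewrite linN // wa !crossingN ?wall_root_root // crossing_gen_wall.
  by rewrite normrN subrr add0r -opprD normrN addrC.
rewrite big_seq_cond [RHS]big_seq_cond; apply: eq_bigr => b /andP[bP bc].
have bR := posroots_root bP; rewrite crossing_comp // crossing_gen_neq ?add0r //.
- by case: wI => _ _ _ h _; apply: h.
- rewrite -wa (inj_eq (lin_inj wI)); case: ca bc => ca; first by rewrite ca.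
  by move=> _; rewrite -[a]opprK -ca posroots_opp.
- rewrite -wa -linN // (inj_eq (lin_inj wI)); case: ca bc => ca.
    by move=> _; rewrite -ca posroots_opp.
  by rewrite ca.
Qed.

(* Exchange: each hyperplane separating the alcove from its image under
   [ev s] is crossed by some letter of [s], which may then be deleted. *)
Lemma word_exchange s a n : a \in roots D -> 0 <= n -> n \is a Num.int ->
  crossing (ev s) a <= - (n + 1) ->
  exists t, size s = (size t).+1 /\ ev t = ev s \o aref a (n + 1 + alcove_floor a).
Proof.
move=> aR n0 nZ; elim: s => [|o s IH].
  by rewrite crossing_id; lra.
have sI := affine_isometry_ev s; have oI := affine_isometry_gen o.
have saR : lin (ev s) a \in roots D by case: sI => _ _ _ h _; apply: h.
have [h _|h] := leP (crossing (ev s) a) (- (n + 1)).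
  by have [t [st et]] := IH h; exists (o :: t); rewrite /= st et.
rewrite ev_cons crossing_comp // => h'.
(* The count drops at the letter [o], so [o] crosses a hyperplane of this family, in the negative
   direction. *)
have sa : lin (ev s) a = - wall_root o.
  apply/eqP; apply: contraT => hN; have [E|hw] := eqVneq (lin (ev s) a) (wall_root o).
    by move: h'; rewrite E crossing_gen_wall; lra.
  by move: h'; rewrite crossing_gen_neq // add0r leNgt h.
(* By integrality the count before [o] is exactly [- n], so [ev s] carries the hyperplane of the
   reflection to the wall of [o]. *)
have sn : crossing (ev s) a = - n.
  move: h'; rewrite sa crossingN ?wall_root_root // crossing_gen_wall => h'.
  have : - (n + 1) + 1 <= crossing (ev s) a.
    by apply: int_lt_le1 => //; rewrite ?crossing_int // rpredN rpredD ?rpred1.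
  by move=> h''; apply/eqP; rewrite eq_le; apply/andP; split; lra.
exists s; split=> //; rewrite -[_ \o _]/(gen o \o (ev s \o _)) aref_conj // sa.
have -> : n + 1 + alcove_floor a + pairing (ev s 0) (- wall_root o) = - wall_level o.
  move: sn; rewrite /crossing sa alcove_floorN ?wall_root_root // alcove_floor_wall.
  lra.
by rewrite arefN -genE; apply: funext => x /=; rewrite genK.
Qed.

Lemma len_id : len idfun = 0.
Proof. by rewrite /len big1 // => a _; rewrite crossing_id normr0. Qed.

Lemma len_gen_cases o w a : words w -> a \in roots D -> lin w a = wall_root o ->
  len (gen o \o w) = if crossing w a < 0 then len w - 1 else len w + 1.
Proof.
move=> wW aR wa; have wI := words_isometry wW; rewrite (len_gen wW aR wa).
case: ltP => h; last by rewrite !ger0_norm //; lra.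
have := int_lt_le1 (crossing_int wI aR) (rpred0 _) h => h1.
by rewrite !ler0_norm //; lra.
Qed.

(** Letters are added one at a time. If the new one lowers [len], its wall was crossed already, and
    exchange deletes a letter instead. *)
Lemma reduced_word s : exists t, ev t = ev s /\ (size t)%:R = len (ev s).
Proof.
elim: s => [|o s [t [et st]]]; first by exists [::]; rewrite len_id.
have sW : words (ev s) by exists s.
have [a aR sa] := words_root_preim sW (wall_root_root o).
rewrite ev_cons (len_gen_cases sW aR sa).
case: ltP => h; last by exists (o :: t); rewrite ev_cons et /= -st -natr1.
have sI := words_isometry sW.
(* With this [n] the exchanged reflection, carried over by [ev s], is [gen o]. *)
have [|||u [su eu]] := @word_exchange t a (- crossing (ev s) a - 1) aR; rewrite ?et.
- have := int_lt_le1 (crossing_int sI aR) (rpred0 _) h; lra.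
- by rewrite rpredB ?rpredN ?crossing_int ?rpred1.
- by rewrite subrK opprK.
exists u; split; last by rewrite -st su -natr1 addrK.
rewrite eu et aref_conj // sa.
rewrite (_ : _ + pairing _ _ = wall_level o) -?genE //.
rewrite /crossing sa alcove_floor_wall; lra.
Qed.

Lemma len_le_size s : len (ev s) <= (size s)%:R.
Proof.
elim: s => [|o s IH]; first by rewrite len_id.
have sW : words (ev s) by exists s.
have [a aR sa] := words_root_preim sW (wall_root_root o).
rewrite ev_cons (len_gen_cases sW aR sa) /= -natr1; case: ifP => _; lra.
Qed.

Lemma length_len w : words w -> (length D w)%:R = len w.
Proof.
move=> [s <-]; have [t [et st]] := reduced_word s; rewrite /length.
set P := (X in xget 0%N X).
have [|[u eu su] h] := @xgetPex _ 0%N P.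
  exists (size t); split=> [|u eu]; first by exists t.
  by rewrite -(ler_nat R) st -eu len_le_size.
apply/eqP; rewrite eq_le -{2}eu -{2}su len_le_size andbT -st ler_nat.
exact: h.
Qed.

Lemma length_gen o w a : words w -> a \in roots D -> lin w a = wall_root o ->
  if crossing w a < 0 then length D w = (length D (gen o \o w)).+1
  else length D (gen o \o w) = (length D w).+1.
Proof.
move=> wW aR wa; have := len_gen_cases wW aR wa.
rewrite -!length_len //; last exact: words_comp (words_gen o) wW.
case: ifP => _ /eqP h; apply/eqP; rewrite -(eqr_nat R) -natr1 //.
by rewrite (eqP h) subrK.
Qed.

(** The first letter of a reduced word: if it raised [len], the remaining word would be shorter than
    its own [len]. *)
Lemma left_descent w : words w -> w <> idfun ->
  exists o a, [/\ a \in roots D, lin w a = wall_root o & crossing w a < 0].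
Proof.
move=> [s <-] wN; have [[|o t] [et st]] := reduced_word s.
  by case: wN; rewrite -et.
have sW : words (ev s) by exists s.
have [a aR wa] := words_root_preim sW (wall_root_root o).
exists o, a; split=> //; rewrite ltNge; apply/negP => h.
have := len_gen_cases sW aR wa; rewrite ltNge h /= -st -et ev_cons.
have -> : gen o \o (gen o \o ev t) = ev t by apply: funext => x /=; rewrite genK.
by have := len_le_size t; rewrite -natr1; lra.
Qed.

End AffineWords.

(** * The affine Weyl group and the alcove *)

Section TransformationGroups.
Variable T : Type.
Implicit Types S G : set (T -> T).

Lemma generated_group S : transformation_group (generated S).
Proof.
split=> [A [[]] //|f g fS gS A AP|f g fS fg gf A AP]; case: (AP) => [[h1 h2 h3] h4].
  by apply: h2; [apply: fS | apply: gS].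
by apply: h3 fg gf; apply: fS.
Qed.

Lemma sub_generated S : S `<=` generated S.
Proof. exact: sub_smallest. Qed.

Lemma generated_sub S G : transformation_group G -> S `<=` G -> generated S `<=` G.
Proof. exact: smallest_sub. Qed.

End TransformationGroups.

Section AffineWeyl.
Variables (R : realType) (V : vectType R) (D : rootSystem V).

Local Notation "'[ u , v ]" := (form D u v) (at level 0).
Local Notation alpha := (tnth (simple D)).
Local Notation shortD := (short (form D) (roots D)).
Local Notation pairing := (pairing D).
Local Notation ht := (ht D).
Local Notation positive := (positive D).
Local Notation beta1 := (beta1 D).
Local Notation gen := (@coxeter_generator _ _ D).
Local Notation aref := (affine_reflection (form D)).
Local Notation words := (words D).
Local Notation alcove := (fundamental_alcove D).

Lemma words_group : transformation_group words.
Proof.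
split=> [|f g fW gW|f g fW fg gf]; [exact: words_id | exact: words_comp |].
have [u [uW fu uf]] := words_inv fW; rewrite (_ : g = u) //.
by apply: funext => x; rewrite -{2}(gf x) fu.
Qed.

Lemma aref_conj_simple i a c :
  gen (Some i) \o aref a c \o gen (Some i) =
  aref (a - pairing a (alpha i) *: alpha i) c.
Proof.
have iR := simple_root i.
have E : gen (Some i) = aref (alpha i) 0 by [].
have wI := affine_isometry_gen (Some i).
apply: funext => x /=; rewrite -[LHS]/(((gen (Some i)) \o aref a c) (gen (Some i) x)).
rewrite aref_conj // /= -/(gen (Some i)) genK.
by rewrite E lin_aref aref0 scale0r pairing0l addr0.
Qed.

Lemma words_aref_simple i a c :
  words (aref (a - pairing a (alpha i) *: alpha i) c) -> words (aref a c).
Proof.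
rewrite -aref_conj_simple => h.
have -> : aref a c = gen (Some i) \o (gen (Some i) \o aref a c \o gen (Some i))
    \o gen (Some i).
  by apply: funext => x /=; rewrite -!/(gen (Some i)) !genK.
by apply: words_comp (words_gen _); apply: words_comp h; apply: words_gen.
Qed.

Lemma words_reflection a : a \in roots D -> words (aref a 0).
Proof.
suff H b : b \in roots D -> positive b -> words (aref b 0).
  move=> aR; have [|p] := root_sign aR; first exact: H.
  by rewrite -arefN oppr0; apply: H; rewrite ?root_oppE.
move: b {a}; apply: (@seq_ind_gt _ _ (roots D) (fun v => - ht v)) => a aR IH pa.
have [i _ ai] := exists_form_gt0 (root_neq0 aR) (supportedT D a) pa.
have iR := simple_root i.
have [->|aDi] := eqVneq a (alpha i); first exact: (words_gen (Some i)).
apply: words_aref_simple (IH _ (refl_root iR aR) _ (positive_refl_simple aR pa aDi)).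
by rewrite ht_refl_simple ltrN2 gtrBl pairing_gt0.
Qed.

Lemma dominant_short_beta1 a : shortD a -> (forall i, 0 <= '[a, alpha i]) ->
  a = beta1.
Proof.
move=> aS da; have bS := short_beta1 D; have cT := @connectedT _ _ D.
have cor c : shortD c -> coroot (form D) c = c.
  by move=> /short_norm cE; rewrite /coroot cE divff ?scale1r ?pnatr_eq0.
have db : dominant_on [set: 'I_(rank D)]%SET beta1.
  by move=> i _; apply: dominant_beta1.
have da' : dominant_on [set: 'I_(rank D)]%SET a by move=> i _; apply: da.
have sT := supportedT D; apply: co_inj => i; apply/eqP; rewrite eq_le.
have := coroot_le_dominant_short cT bS (sT _) db (short_root aS) (sT _) i.
have := coroot_le_dominant_short cT aS (sT _) da' (short_root bS) (sT _) i.
by rewrite !cor // => -> ->.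
Qed.

(** Conjugation by simple reflections climbs to the dominant short root [beta1], where the
    reflection is [s0]. *)
Lemma words_short_aref a : shortD a -> words (aref a 1).
Proof.
move=> aS; have aR := short_root aS; move: a aR aS.
apply: (@seq_ind_gt _ _ (roots D) ht) => a aR IH aS.
have [/existsP[i ai]|/existsPn da] := boolP [exists i, '[a, alpha i] < 0].
  have iR := simple_root i.
  apply: (words_aref_simple (i := i)); apply: IH.
  - exact: refl_root.
  - by rewrite ht_refl_simple ltrDl oppr_gt0 pairing_lt0.
  - exact: short_refl.
rewrite (dominant_short_beta1 aS); first exact: (words_gen None).
by move=> i; rewrite leNgt.
Qed.

Lemma translationE a : a \in roots D -> aref a 1 \o aref a 0 = translation a.
Proof.
move=> aR; apply: funext => x /=; rewrite !arefE subr0 pairingBl pairingZl.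
rewrite pairing_self // -addrA -opprD -scalerDl /translation.
have -> : forall p : R, p + (p - p * 2 - 1) = -1 by move=> p; ring.
by rewrite scaleN1r opprK.
Qed.

(** For a short root, multiply two parallel reflections; a long root is a difference of two short
    ones. *)
Lemma words_translation a : a \in roots D -> words (translation a).
Proof.
have H b : shortD b -> words (translation b).
  move=> bS; rewrite -translationE ?short_root //.
  by apply: words_comp; [apply: words_short_aref | apply/words_reflection/short_root].
move=> aR; have [aS|aL] := boolP (shortD a); first exact: H.
have [b bS cS] := exists_short_sub aR aL.
have -> : translation a = translation b \o translation (- (b - a)).
  by apply: funext => x; rewrite /translation /= opprB addrA addrNK.
by apply: words_comp; apply: H => //; apply: short_opp.
Qed.

Lemma weyl_reflection a : a \in roots D -> weyl D (aref a 0).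
Proof. by move=> aR; apply: sub_generated; exists a. Qed.

Lemma affine_weylE : affine_weyl D = words.
Proof.
have wR : weyl D `<=` words.
  apply: generated_sub words_group _ => _ [a aR <-]; exact: (words_reflection aR).
apply/seteqP; split.
  apply: generated_sub words_group _ => w [/wR //|[a aR <-]].
  exact: (words_translation aR).
have [AI AM AV] := generated_group (weyl D `|` [set @translation R V a | a in [set` roots D]]).
have AR a : a \in roots D -> affine_weyl D (aref a 0).
  by move=> aR; apply: sub_generated; left; apply: weyl_reflection.
move=> _ [s <-]; elim: s => // o s IH; apply: (AM _ _ _ IH).
case: o => [i|]; first exact: (AR _ (simple_root i)).
have bR := root_beta1 D; rewrite (_ : gen None = translation beta1 \o aref beta1 0).
  by apply: (AM _ _ _ (AR _ bR)); apply: sub_generated; right; exists beta1.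
by rewrite -translationE //; apply: funext => x /=; rewrite arefK.
Qed.

Lemma gen_fix o x : gen o x = x <-> pairing x (wall_root o) = wall_level o.
Proof.
rewrite genE; split=> [/eqP|/eqP h]; first by rewrite aref_fix ?wall_root_root // => /eqP.
by apply/eqP; rewrite aref_fix ?wall_root_root.
Qed.

(** Position of [x] relative to the strip of the alcove in direction [a]; on the alcove it runs from
    0 to 1, the ends being hyperplanes. *)
Definition gap (x a : V) : R := pairing x a - alcove_floor D a.

Lemma gap_alcove x a : alcove x -> a \in roots D -> 0 <= gap x a <= 1.
Proof.
move=> xA aR; rewrite /gap /alcove_floor; case: ifP => [p|/negbT p].
  by rewrite subr0 pairing_ge0 // (alcove_ge0 xA p) alcove_le1.
rewrite opprK -lerBlDr sub0r alcove_geN1 //= -lerBrDr subrr.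
rewrite -positive_opp // in p; rewrite -oppr_ge0 -pairingNr.
by rewrite pairing_ge0 ?root_oppE // alcove_ge0.
Qed.

Lemma gapN x a : a \in roots D -> gap x (- a) = 1 - gap x a.
Proof. by move=> aR; rewrite /gap pairingNr alcove_floorN //; ring. Qed.

Lemma gen_fix_gap o x : gen o x = x <-> gap x (wall_root o) = 0.
Proof.
rewrite gen_fix /gap alcove_floor_wall; split=> [->|/eqP]; first by rewrite subrr.
by rewrite subr_eq0 => /eqP.
Qed.

(** As [x] is arbitrary, crossing numbers can be read off at a fixed point of [w], at an interior
    point, or at the preimage of 0. *)
Lemma crossing_gap w x a : affine_isometry D w ->
  crossing D w a = gap (w x) (lin w a) - gap x a.
Proof.
by move=> wI; rewrite /crossing /gap (linE w x) pairingDl pairing_lin //; ring.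
Qed.

Lemma lin_root w a : words w -> a \in roots D -> lin w a \in roots D.
Proof. by move=> /words_isometry[_ _ _ h _]; apply: h. Qed.

Lemma words_crossing_int w a : words w -> a \in roots D ->
  crossing D w a \is a Num.int.
Proof. by move=> /words_isometry wI; apply: crossing_int. Qed.

(** The gap falls by at least 1 between values in the interval from 0 to 1, so it ends at 0. *)
Lemma descent_fix w x o a : words w -> alcove x -> alcove (w x) ->
  a \in roots D -> lin w a = wall_root o -> crossing D w a < 0 ->
  gen o (w x) = w x.
Proof.
move=> wW xA wA aR wa h; apply/gen_fix_gap.
have h1 := int_lt_le1 (words_crossing_int wW aR) (rpred0 _) h.
move: h1; rewrite (crossing_gap x _ (words_isometry wW)) wa => h1.
have /andP[_ h2] := gap_alcove xA aR.
have /andP[h3 _] := gap_alcove wA (wall_root_root o).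
by apply/eqP; rewrite eq_le h3 andbT; lra.
Qed.

(** Induct on the length: a left descent fixes [w x] and is stripped off, so every letter removed
    fixes the common point. *)
Lemma alcove_strict_domain w x : words w -> alcove x -> alcove (w x) ->
  w x = x /\ exists2 s, word_eval s = w & forall o, o \in s -> gen o x = x.
Proof.
have [n] := ubnP (length D w); elim: n w => // n IH w; rewrite ltnS => wn wW xA wA.
have [->|wN] := pselect (w = idfun); first by split=> //; exists [::].
have [o [a [aR wa h]]] := left_descent wW wN.
have owx := descent_fix wW xA wA aR wa h.
have uW := words_comp (words_gen o) wW.
have := length_gen wW aR wa; rewrite h => wl.
have [||ux [s su sx]] := IH (gen o \o w) _ uW xA; rewrite /= ?owx //.
  by apply: leq_trans wn; rewrite wl.
rewrite /= owx in ux; split=> //; exists (o :: s).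
  by rewrite ev_cons su; apply: funext => y /=; rewrite genK.
by move=> o'; rewrite inE => /orP[/eqP ->|/sx //]; rewrite -ux.
Qed.

End AffineWeyl.

(** * Shortest coset representatives and longest elements *)

Section Parabolic.
Variables (R : realType) (V : vectType R) (D : rootSystem V).

Local Notation "'[ u , v ]" := (form D u v) (at level 0).
Local Notation alpha := (tnth (simple D)).
Local Notation pairing := (pairing D).
Local Notation positive := (positive D).
Local Notation beta1 := (beta1 D).
Local Notation gen := (@coxeter_generator _ _ D).
Local Notation words := (words D).
Local Notation alcove := (fundamental_alcove D).
Local Notation gap := (gap D).
Local Notation crossing := (crossing D).
Local Notation posroots := (posroots D).
Local Notation len := (len D).

Lemma alcove0 : alcove 0.
Proof. by split=> [i|]; rewrite form0l ?ler01. Qed.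

(** An element fixing 0 is a word in generators fixing 0, and [s0] moves 0. *)
Lemma weylE : weyl D = [set w | words w /\ w 0 = 0].
Proof.
apply/seteqP; split=> w.
  move: w; apply: generated_sub => [|_ [a aR <-]]; last first.
    split; first exact: (words_reflection aR).
    by rewrite reflectionE pairing0l scale0r subr0.
  have [W1 W2 W3] := words_group D.
  split=> [|f g [fW f0] [gW g0]|f g [fW f0] fg gf]; first by split.
    by split; [exact: W2 | rewrite /= g0].
  by split; [exact: W3 fW fg gf | rewrite -{1}f0 fg].
move=> [wW w0]; have [|_ [s <- sx]] := alcove_strict_domain wW alcove0; rewrite ?w0.
  exact: alcove0.
have [G1 G2 G3] := generated_group [set reflection (form D) a | a in [set` roots D]].
elim: s {wW w0} sx => // o s IH sx; apply: (G2 _ _ _ (IH _)) => [|o' o's]; last first.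
  by apply: sx; rewrite inE o's orbT.
have : gen o 0 = 0 by apply: sx; rewrite mem_head.
case: o sx => [i|] sx; first by move=> _; apply: (weyl_reflection (simple_root i)).
move=> /(gen_fix_gap _ _); rewrite /gap alcove_floor_wall pairing0l sub0r opprK => /eqP.
by rewrite oner_eq0.
Qed.

(** The Gram matrix of the simple roots is invertible, since a kernel vector yields an element of
    norm 0. *)
Lemma exists_dual_vector : exists p, forall i, '[p, alpha i] = 1.
Proof.
pose G := \matrix_(i < rank D, j < rank D) '[alpha i, alpha j].
have E (u : 'rV[R]_(rank D)) j : '[\sum_i u 0 i *: alpha i, alpha j] = (u *m G) 0 j.
  rewrite form_suml mxE; apply: eq_bigr => i _.
  by rewrite formZl mxE.
have Gu : G \in unitmx.
  rewrite -row_free_unit -kermx_eq0; apply/rowV0P => u /sub_kermxP uG.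
  set w := \sum_i u 0 i *: alpha i.
  have w0 : w = 0.
    apply/eqP; rewrite -(form_eq0 D) {2}/w form_sumr big1 // => j _.
    by rewrite formZr E uG mxE mulr0.
  apply/rowP => i; rewrite mxE -[RHS](co0 i) -w0 co_sum (bigD1 i) //=.
  rewrite coZ co_simple eqxx mulr1 big1 ?addr0 // => j ji.
  by rewrite coZ co_simple (negbTE ji) mulr0.
exists (\sum_i (const_mx 1 *m invmx G) (0 : 'I_1) i *: alpha i) => j.
by rewrite E mulmxKV // mxE.
Qed.

Lemma exists_interior : exists p, alcove p /\ forall a, a \in roots D -> 0 < gap p a < 1.
Proof.
have [q hq] := exists_dual_vector; pose m := '[q, beta1].
have m0 : 0 <= m.
  apply: (@dominant_on_form _ _ _ [set: 'I_(rank D)]%SET).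
  - by move=> i _; rewrite hq ler01.
  - exact: supportedT.
  - exact: positive_beta1.
(* The factor brings the product with [beta1] down to m / (1 + m), below 1. *)
pose p := (1 + m)^-1 *: q; have m1 : 0 < (1 + m)^-1 by rewrite invr_gt0; lra.
have pa i : 0 < '[p, alpha i] by rewrite formZl hq mulr1.
have pb : '[p, beta1] < 1.
  by rewrite formZl -/m mulrC ltr_pdivrMr; lra.
have dp : dominant_on [set: 'I_(rank D)]%SET p by move=> i _; apply: ltW.
have db : dominant_on [set: 'I_(rank D)]%SET beta1 by move=> i _; apply: dominant_beta1.
have sT := supportedT D; have bS := short_beta1 D.
have H a : a \in roots D -> positive a -> 0 < pairing p a < 1.
  move=> aR aP; apply/andP; split.
    have [i ai] := neq0_co D (root_neq0 aR).
    rewrite pairing_gt0 // form_co (bigD1 i) //= ltr_pwDl //.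
      by rewrite mulr_gt0 // lt_def ai (positiveP _ _ aP).
    by apply: sumr_ge0 => j _; rewrite mulr_ge0 ?(positiveP _ _ aP) // ltW.
  apply: le_lt_trans pb.
  exact: (pairing_le_largest (@connectedT _ _ D) bS (sT _) db dp aR (sT _)).
have Hg a : a \in roots D -> positive a -> 0 < gap p a < 1.
  by move=> aR aP; rewrite /gap /alcove_floor aP subr0 H.
exists p; split.
  split; first by apply/dominantE => i; apply: ltW.
  by rewrite -/(pairing p beta1) pairing_short // ltW.
move=> a aR; have [aP|aP] := root_sign aR; first exact: Hg.
have := Hg (- a); rewrite root_oppE gapN // => /(_ aR aP); lra.
Qed.

(* The affine functions [gap^~ b] with [gap x b = 0] are nonnegative
   combinations of those of the walls through [x]. *)
Lemma gap_wall_sign (x z : V) (e : R) b : alcove x -> b \in roots D ->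
  gap x b = 0 -> (forall o, gen o x = x -> 0 < e * gap z (wall_root o)) ->
  0 < e * gap z b.
Proof.
move=> xA bR xb hz.
have xd i : 0 <= '[x, alpha i] by apply: alcove_simple.
have H (c : 'I_(rank D) -> R) : (forall i, 0 <= c i) ->
    \sum_i c i * '[x, alpha i] = 0 -> forall i,
    0 <= c i * (e * '[z, alpha i]) /\ (c i != 0 -> 0 < c i * (e * '[z, alpha i])).
  move=> c0 cx i.
  have ci0 : c i != 0 -> 0 < c i * (e * '[z, alpha i]).
    move=> ci; apply: mulr_gt0; first by rewrite lt_def ci c0.
    have : 0 < e * gap z (wall_root (Some i)).
      apply: hz; apply/gen_fix; apply/eqP; rewrite pairing_eq0 ?wall_root_root //=.
      move/eqP: cx; rewrite psumr_eq0 => [/allP/(_ i)|j _]; last by rewrite mulr_ge0.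
      by rewrite mem_index_enum => /(_ isT); rewrite mulf_eq0 (negbTE ci).
    rewrite /gap alcove_floor_wall subr0 -pairingZl pairing_gt0 ?wall_root_root //.
    by rewrite formZl.
  split=> //; have [->|/ci0/ltW //] := eqVneq (c i) 0.
  by rewrite mul0r.
have corE y a : pairing y a = \sum_i co i (coroot (form D) a) * '[y, alpha i].
  exact: pairing_co.
have corZ (y : V) (c : 'I_(rank D) -> R) : e * (\sum_i c i * '[y, alpha i]) =
    \sum_i c i * (e * '[y, alpha i]).
  by rewrite mulr_sumr; apply: eq_bigr => i _; rewrite mulrCA.
have [bP|bN] := root_sign bR.
  have gapE y : gap y b = \sum_i co i (coroot (form D) b) * '[y, alpha i].
    by rewrite /gap /alcove_floor bP subr0 corE.
  have c0 (i : 'I_(rank D)) : 0 <= co i (coroot (form D) b).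
    by rewrite coZ mulr_ge0 ?(positiveP _ _ bP) // divr_ge0 // ltW // root_norm_gt0.
  rewrite gapE in xb; rewrite gapE corZ.
  have [i bi] := neq0_co D (root_neq0 bR).
  rewrite (bigD1 i) //= ltr_pwDl ?sumr_ge0 // => [|j _]; last first.
    by have [] := H _ c0 xb j.
  have [_ ->//] := H _ c0 xb i.
  by rewrite coZ mulf_neq0 // mulf_neq0 ?invr_eq0 ?gt_eqF ?root_norm_gt0 // ltr0n.
have nbR : - b \in roots D by rewrite root_oppE.
pose o0 : option 'I_(rank D) := None.
(* For negative [b] the wall of [s0] enters: the gap of [b] is that of this wall plus the
   combination of simple roots with these coefficients, which the bound on coroots makes
   nonnegative. *)
pose c (i : 'I_(rank D)) := co i beta1 - co i (coroot (form D) (- b)).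
have db : dominant_on [set: 'I_(rank D)]%SET beta1 by move=> i _; apply: dominant_beta1.
have sT := supportedT D; have bS := short_beta1 D.
have c0 i : 0 <= c i.
  rewrite subr_ge0.
  exact: (coroot_le_dominant_short (@connectedT _ _ D) bS (sT _) db nbR (sT _)).
have gapE y : gap y b = gap y (wall_root o0) + \sum_i c i * '[y, alpha i].
  have -> : \sum_i c i * '[y, alpha i] = '[y, beta1] - pairing y (- b).
    by rewrite corE form_co -sumrB; apply: eq_bigr => i _; rewrite mulrBl.
  rewrite /gap alcove_floor_wall /= -[in LHS](opprK b) alcove_floorN //.
  rewrite {1}/alcove_floor bN !pairingNr (pairing_short _ bS); ring.
have s0 : 0 <= \sum_i c i * '[x, alpha i] by rewrite sumr_ge0 // => i _; rewrite mulr_ge0.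
have g0 := gap_alcove xA (wall_root_root o0).
rewrite gapE in xb; rewrite gapE mulrDr corZ.
have [xN xc] : gap x (wall_root o0) = 0 /\ \sum_i c i * '[x, alpha i] = 0.
  by move/andP: g0 => [g0 _]; split; lra.
rewrite ltr_pwDl ?sumr_ge0 // => [|i _]; last by have [] := H _ c0 xc i.
by apply: hz; apply/gen_fix_gap.
Qed.

(** The local condition for [w] to be shortest among the [h \o w] with [h] fixing [x];
    [all_descents] is the one for the longest. *)
Definition no_descent (w : V -> V) (x : V) : Prop := forall o a,
  gen o x = x -> a \in roots D -> lin w a = wall_root o -> 0 <= crossing w a.

Definition all_descents (w : V -> V) (x : V) : Prop := forall o a,
  gen o x = x -> a \in roots D -> lin w a = wall_root o -> crossing w a < 0.

(** For an interior point [p], the image [w p] is on the positive side of all walls through [x],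
    hence by [gap_wall_sign] for every root with gap 0 at [x]; a negative crossing number would
    contradict this. *)
Lemma no_descent_root w x a : words w -> alcove x -> no_descent w x ->
  a \in roots D -> gap x (lin w a) = 0 -> 0 <= crossing w a.
Proof.
move=> wW xA nd aR xa; have [p [pA hp]] := exists_interior.
have wI := words_isometry wW.
have : 0 < 1 * gap (w p) (lin w a).
  apply: (gap_wall_sign xA (lin_root wW aR) xa) => o ox.
  have [b bR wb] := words_root_preim wW (wall_root_root o).
  have := nd o b ox bR wb; rewrite (crossing_gap p _ wI) wb mul1r.
  by have /andP[] := hp b bR; lra.
rewrite mul1r => h; rewrite leNgt; apply/negP => /(int_lt_le1 (words_crossing_int wW aR) (rpred0 _)).
by have := hp a aR; rewrite (crossing_gap p _ wI); lra.
Qed.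

Lemma all_descents_root w x a : words w -> alcove x -> all_descents w x ->
  a \in roots D -> gap x (lin w a) = 0 -> crossing w a < 0.
Proof.
move=> wW xA ad aR xa; have [p [pA hp]] := exists_interior.
have wI := words_isometry wW.
have : 0 < -1 * gap (w p) (lin w a).
  apply: (gap_wall_sign xA (lin_root wW aR) xa) => o ox.
  have [b bR wb] := words_root_preim wW (wall_root_root o).
  have := int_lt_le1 (words_crossing_int wW bR) (rpred0 _) (ad o b ox bR wb).
  rewrite (crossing_gap p _ wI) wb mulN1r.
  by have /andP[] := hp b bR; lra.
by have := hp a aR; rewrite mulN1r (crossing_gap p _ wI); lra.
Qed.

(** The linear part of [w] permutes the pairs of opposite roots, and [F] depends only on the
    pair. *)
Lemma sum_posroots_lin (M : nmodType) w (F : V -> M) : words w ->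
  (forall a, a \in roots D -> F (- a) = F a) ->
  \sum_(a <- posroots) F (lin w a) = \sum_(a <- posroots) F a.
Proof.
move=> wW Fe; have wI := words_isometry wW.
pose h a := if positive (lin w a) then lin w a else - lin w a.
have hE a : h a = lin w a \/ h a = - lin w a by rewrite /h; case: ifP; [left|right].
rewrite (eq_big_seq (F \o h)) => [|a aP]; last first.
  have aR := posroots_root aP; have waR := lin_root wW aR.
  by rewrite /= /h; case: ifP => // _; rewrite Fe.
rewrite -(big_map h xpredT F); apply/perm_big/uniq_perm; last 1 first.
- move=> b; apply/mapP/idP => [[a aP ->]|bP].
    have waR := lin_root wW (posroots_root aP).
    rewrite /h mem_posroots; case: ifP => p; first by rewrite waR p.
    by rewrite root_oppE waR positive_opp // p.
  have bR := posroots_root bP; have [a aR wa] := words_root_preim wW bR.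
  have pb : positive b by move: bP; rewrite mem_posroots => /andP[].
  have [p|p] := root_sign aR.
    by exists a; rewrite ?mem_posroots ?aR ?p // /h wa pb.
  exists (- a); first by rewrite mem_posroots root_oppE aR p.
  by rewrite /h (linN _ wI) wa positive_opp // pb opprK.
- rewrite map_inj_in_uniq ?posroots_uniq // => a b aP bP hab.
  apply: (lin_inj wI); have := posroots_opp aP bP.
  rewrite -(inj_eq (lin_inj wI)) (linN _ wI).
  by case: (hE a) (hE b) hab => -> [] -> // /eqP;
    rewrite ?eqr_oppLR ?opprK => /eqP ->; rewrite ?opprK ?eqxx.
- exact: posroots_uniq.
Qed.

(** The crossing numbers of [h] and [d] never have opposite signs: where that of [h] is nonzero, the
    gap at [x] is 0 or 1, and [no_descent_root] gives the sign for [d]. *)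
Lemma len_comp_min h d x : words h -> words d -> alcove x -> h x = x ->
  no_descent d x -> len (h \o d) = len h + len d.
Proof.
move=> hW dW xA hx nd; have hI := words_isometry hW; have dI := words_isometry dW.
have -> : len h = \sum_(a <- posroots) `|crossing h (lin d a)|.
  symmetry; apply: (@sum_posroots_lin _ d (fun a => `|crossing h a|) dW) => a aR.
  by rewrite crossingN // normrN.
rewrite /len -big_split /= big_seq [RHS]big_seq; apply: eq_bigr => a aP.
have aR := posroots_root aP; have bR := lin_root dW aR.
rewrite crossing_comp //; set b := lin d a in bR *.
have := gap_alcove xA bR; have := gap_alcove xA (lin_root hW bR).
have := crossing_gap x b hI; rewrite hx => -> g1 g2.
have kZ := words_crossing_int hW bR; have kE := crossing_gap x b hI.
rewrite hx in kE; rewrite -kE; have [k0|k0|<-] := ltgtP 0 (crossing h b).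
- have k1 := int_lt_le1 (rpred0 _) kZ k0.
  have dk : 0 <= crossing d a.
    by apply: no_descent_root nd aR _ => //; rewrite -/b; lra.
  by rewrite (ger0_norm (ltW k0)) (ger0_norm dk) ger0_norm // addr_ge0 // ltW.
- have k1 := int_lt_le1 kZ (rpred0 _) k0.
  have dk : crossing d a <= 0.
    rewrite -oppr_ge0 -crossingN //; apply: (no_descent_root dW xA nd).
      by rewrite root_oppE.
    by rewrite (linN _ dI) gapN //; lra.
  by rewrite !ler0_norm //; lra.
- by rewrite normr0 !add0r.
Qed.

(** Remove descents at [x] one by one. By [descent_fix] each generator used fixes [F] pointwise,
    which later keeps [lambda], or [lambda] and 0, in place. *)
Lemma exists_min_coset (F : set V) x y w : F `<=` alcove -> alcove x -> words w ->
  (forall z, F z -> w z = z) -> w y = x ->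
  exists d, [/\ words d, forall z, F z -> d z = z, d y = x & no_descent d x].
Proof.
move=> FA xA; have [n] := ubnP (length D w); elim: n w => // n IH w.
rewrite ltnS => wn wW wF wy; have [nd|] := pselect (no_descent w x).
  by exists w.
move=> nnd; have [o [a [ox aR wa h]]] : exists o a,
    [/\ gen o x = x, a \in roots D, lin w a = wall_root o & crossing w a < 0].
  apply: contrapT => H; apply: nnd => o a ox aR wa; rewrite leNgt; apply/negP => h.
  by apply: H; exists o, a.
have := length_gen wW aR wa; rewrite h => wl.
apply: (IH (gen o \o w)).
- by apply: leq_trans wn; rewrite wl.
- exact: words_comp (words_gen o) wW.
- move=> z Fz /=; rewrite wF //; have := @descent_fix _ _ D w z o a wW.
  by rewrite wF //; apply=> //; apply: FA.
- by rewrite /= wy.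
Qed.

(** For [x] in the alcove, the number of hyperplanes through [x]. *)
Definition max_len (x : V) : R :=
  \sum_(a <- posroots) ((gap x a == 0) || (gap x a == 1))%:R.

(** A crossing number is here an integral difference of two gaps at [x], so it is at most 1 in
    absolute value, and 0 where the gap is strictly between 0 and 1. *)
Lemma stab_len_le w x : words w -> alcove x -> w x = x -> len w <= max_len x.
Proof.
move=> wW xA wx; rewrite /len /max_len big_seq [leRHS]big_seq ler_sum // => a aP.
have aR := posroots_root aP; have kZ := words_crossing_int wW aR.
have := crossing_gap x a (words_isometry wW); rewrite wx.
have := gap_alcove xA aR; have := gap_alcove xA (lin_root wW aR).
set k := crossing w a in kZ * => /andP[h1 h2] /andP[h3 h4] kE.
have k1 : -1 <= k <= 1 by lra.
case: eqP => [_|g0] /=; first by rewrite ler_norml.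
case: eqP => [_|g1] /=; first by rewrite ler_norml.
have {}h3 : 0 < gap x a by rewrite lt_def h3 andbT; apply/eqP.
have {}h4 : gap x a < 1 by rewrite lt_def h4 andbT eq_sym; apply/eqP.
rewrite normr_le0 eq_le; apply/andP; split; rewrite leNgt; apply/negP => k0.
  by have := int_lt_le1 (rpred0 _) kZ k0; lra.
by have := int_lt_le1 kZ (rpred0 _) k0; lra.
Qed.

(** Multiply by generators through [x] that raise the length, which [stab_len_le] bounds. In the end
    all of them are descents, and every hyperplane through [x] is crossed. *)
Lemma exists_max_len x : alcove x -> exists w, [/\ words w, w x = x & len w = max_len x].
Proof.
move=> xA; suff [w [wW wx ad]] : exists w, [/\ words w, w x = x & all_descents w x].
  exists w; split=> //; apply: eq_big_seq => a aP.
  have aR := posroots_root aP; have wI := words_isometry wW.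
  have := crossing_gap x a wI; rewrite wx => kE.
  have H b : b \in roots D -> gap x b = 0 -> crossing w b = 1.
    move=> bR b0; have kZ := words_crossing_int wW bR.
    have := crossing_gap x b wI; rewrite wx b0 subr0 => E.
    have /andP[h1 h2] := gap_alcove xA (lin_root wW bR).
    have [E0|E0] := eqVneq (crossing w b) 0.
      have := all_descents_root wW xA ad bR; rewrite -E E0 ltxx => /(_ erefl) //.
    apply/eqP; rewrite eq_le E h2 /= -E -[1]add0r int_lt_le1 ?rpred0 //.
    by rewrite lt_def E0 E.
  case: eqP => [g0|g0] /=; first by rewrite H // normr1.
  case: eqP => [g1|g1] /=.
    by rewrite -normrN -crossingN // H ?normr1 ?root_oppE // gapN // g1 subrr.
  apply/eqP; rewrite -normr_eq0 normr_id normr_eq0.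
  have kZ := words_crossing_int wW aR.
  have /andP[h1 h2] := gap_alcove xA (lin_root wW aR).
  have /andP[h3 h4] := gap_alcove xA aR.
  have {}h3 : 0 < gap x a by rewrite lt_def h3 andbT; apply/eqP.
  have {}h4 : gap x a < 1 by rewrite lt_def h4 andbT eq_sym; apply/eqP.
  rewrite eq_le; apply/andP; split; rewrite leNgt; apply/negP => k0.
    by have := int_lt_le1 (rpred0 _) kZ k0; lra.
  by have := int_lt_le1 kZ (rpred0 _) k0; lra.
have [N hN] : exists N : nat, forall w, words w -> w x = x -> (length D w < N)%N.
  exists (size posroots).+1 => w wW wx; rewrite ltnS -(ler_nat R) length_len //.
  apply: le_trans (stab_len_le wW xA wx) _.
  rewrite /max_len -sum1_size natr_sum ler_sum // => a _.
  by case: (_ || _); rewrite ?ler01.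
suff H k : forall w, words w -> w x = x -> (N <= length D w + k)%N ->
    exists w, [/\ words w, w x = x & all_descents w x].
  by apply: (H N idfun (words_id D) erefl); rewrite leq_addl.
elim: k => [|k IH] w wW wx; first by rewrite addn0 leqNgt hN.
move=> wN; have [ad|nad] := pselect (all_descents w x); first by exists w.
have [o [a [ox aR wa h]]] : exists o a,
    [/\ gen o x = x, a \in roots D, lin w a = wall_root o & 0 <= crossing w a].
  apply: contrapT => H; apply: nad => o a ox aR wa; rewrite ltNge; apply/negP => h.
  by apply: H; exists o, a.
have := length_gen wW aR wa; rewrite ltNge h /= => wl.
apply: (IH (gen o \o w)); rewrite /= ?wx //.
  exact: words_comp (words_gen o) wW.
by rewrite wl addSn -addnS.
Qed.

End Parabolic.

(** * Orbits of nearest lattice points *)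

Section Orbits.
Variables (R : realType) (V : vectType R) (D : rootSystem V).

Local Notation "'[ u , v ]" := (form D u v) (at level 0).
Local Notation alpha := (tnth (simple D)).
Local Notation shortD := (short (form D) (roots D)).
Local Notation pairing := (pairing D).
Local Notation positive := (positive D).
Local Notation beta1 := (beta1 D).
Local Notation gen := (@coxeter_generator _ _ D).
Local Notation words := (words D).
Local Notation alcove := (fundamental_alcove D).
Local Notation gap := (gap D).
Local Notation crossing := (crossing D).
Local Notation posroots := (posroots D).
Local Notation len := (len D).
Local Notation lattice := (lattice D).

Lemma finite_bounded_words n : finite_set [set w | words w /\ (length D w <= n)%N].
Proof.
pose f (s : n.-bseq (option 'I_(rank D))) := word_eval s.
apply: (@sub_finite_set _ _ (range f)); last exact/finite_image/finite_finset.
move=> w [wW wn]; have [s sw] := wW; have [t [et st]] := reduced_word s.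
have tn : (size t <= n)%N.
  apply: leq_trans wn; rewrite -(ler_nat R) length_len // st sw //.
by exists (Bseq tn) => //=; rewrite /f /= et.
Qed.

Lemma finite_stab x : alcove x -> finite_set [set w | words w /\ w x = x].
Proof.
move=> xA; apply: sub_finite_set (finite_bounded_words (size posroots)).
move=> w [wW wx]; split=> //; rewrite -(ler_nat R) length_len //.
apply: le_trans (stab_len_le wW xA wx) _.
rewrite /max_len -sum1_size natr_sum ler_sum // => a _.
by case: (_ || _); rewrite ?ler01.
Qed.

Lemma words_translation_lattice v : lattice v -> words (translation v).
Proof.
move=> vL; have [s [sR ->]] := root_sum_exists (supportedT D v) vL.
elim: s sR => [|a s IH] sR.
  rewrite big_nil (_ : translation 0 = idfun); first exact: words_id.
  by apply: funext => x; rewrite /translation addr0.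
have -> : translation (\sum_(b <- a :: s) b) =
    translation a \o translation (\sum_(b <- s) b).
  by apply: funext => x; rewrite /translation /= big_cons -addrA [_ + a]addrC.
apply: words_comp; first by apply: words_translation; have [] := sR a (mem_head _ _).
by apply: IH => b bs; apply: sR; rewrite inE bs orbT.
Qed.

Lemma words_linear w x : words w -> w 0 = 0 -> w x = lin w x.
Proof. by move=> wW w0; rewrite /lin w0 subr0. Qed.

Lemma words_isom w x y : words w -> w 0 = 0 -> '[w x, w y] = '[x, y].
Proof.
move=> wW w0; rewrite !(words_linear _ wW w0).
by case: (words_isometry wW) => _ _ h _ _; apply: h.
Qed.

Lemma wordsZ w c x : words w -> w 0 = 0 -> w (c *: x) = c *: w x.
Proof.
move=> wW w0; rewrite !(words_linear _ wW w0).
by case: (words_isometry wW) => _ h _ _ _; apply: h.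
Qed.

Lemma gen_simple0 i : gen (Some i) 0 = 0.
Proof. by apply/gen_fix; rewrite pairing0l. Qed.

(** Reflecting at a negative product raises (q, u v), as [q] has product 1 with every simple root.
    Closure of [H] is asked only there, since for [stab_weyl] it is derived from negativity. *)
Lemma exists_dominant_orbit (H : set (V -> V)) v : finite_set H -> H idfun ->
  (forall u i, H u -> '[u v, alpha i] < 0 -> H (gen (Some i) \o u)) ->
  exists2 u, H u & forall i, 0 <= '[u v, alpha i].
Proof.
move=> /finite_seqP[s sE] Hid HS; have [q hq] := exists_dual_vector D.
have sP u : H u <-> u \in s by rewrite sE.
have : idfun \in s by apply/sP.
move: (idfun) => u; move: u.
apply: (@seq_ind_gt _ _ s (fun u => '[q, u v])) => u us IH.
have [/existsP[i ui]|/existsPn ud] := boolP [exists i, '[u v, alpha i] < 0]; last first.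
  by exists u; [apply/sP | move=> i; rewrite leNgt].
have iR := simple_root i; apply: (IH (gen (Some i) \o u)); first exact/sP/HS/ui/sP.
rewrite /= -/(reflection (form D) (alpha i) (u v)) reflectionE formBr formZr hq mulr1.
by rewrite ltrDl oppr_gt0 pairing_lt0.
Qed.

Section Point.
Variables (lambda : V) (hlambda : alcove lambda).

Local Notation nearest := (nearest D lambda).

Definition stab_affine : set (V -> V) := [set w | words w /\ w lambda = lambda].
Definition stab_weyl : set (V -> V) :=
  [set w | [/\ words w, w 0 = 0 & w lambda = lambda]].

Lemma finite_stab_affine : finite_set stab_affine.
Proof. exact: finite_stab. Qed.

Lemma finite_stab_weyl : finite_set stab_weyl.
Proof. by apply: sub_finite_set finite_stab_affine => w []. Qed.

Lemma nearest_stab_weyl u v : stab_weyl u -> nearest v -> nearest (u v).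
Proof.
move=> [uW u0 ul] [vL vE]; split.
  rewrite (words_linear _ uW u0); apply: lattice_lin => //; exact: words_isometry.
have -> : '[u v, lambda] = '[v, lambda] by rewrite -{1}ul words_isom.
by rewrite words_isom.
Qed.

(** Translate [v] to 0 and make [lambda - v] dominant: the image of [lambda] lies in the alcove, so
    it is [lambda]. Conversely, [w] preserves distances. *)
Lemma nearest_orbit0 v : nearest v <-> exists2 w, stab_affine w & w v = 0.
Proof.
split=> [[vL vE]|[w [wW wl] wv]].
  have [u [uW u0] ud] : exists2 u, (words u /\ u 0 = 0) &
      forall i, 0 <= '[u (lambda - v), alpha i].
    apply: exists_dominant_orbit => [||u i [uW u0] _].
    - exact: finite_stab (alcove0 D).
    - by split=> //; apply: words_id.
    - split; first exact: words_comp (words_gen (Some i)) uW.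
      by rewrite /= u0 -[RHS](gen_simple0 i).
  have tW := words_translation_lattice (latticeN vL).
  pose w := u \o translation (- v); have wW : words w := words_comp uW tW.
  exists w; last by rewrite /w /= /translation subrr.
  split=> //; have [] // := alcove_strict_domain wW hlambda.
  have uI := words_isometry uW.
  split; first exact/dominantE.
  rewrite -/(pairing _ _) pairing_short ?short_beta1 //.
  have [b bR ub] := words_root_preim uW (root_beta1 D).
  have bE : '[b, b] = 2.
    by case: uI => _ _ <- _ _; rewrite ub short_norm // short_beta1.
  (* The bound at [beta1] is the norm inequality for the lattice point [v + b]. *)
  have := lattice_norm_ge hlambda (latticeD vL (lattice_root bR)).
  have -> : '[w lambda, beta1] = '[lambda - v, b].
    by rewrite -ub /w /= (words_linear _ uW u0); case: uI => _ _ -> _ _.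
  rewrite !formE bE vE (formC D b v) (formC D lambda b); lra.
have wI := words_isometry wW; have [u [uW wu uw]] := words_inv wW.
have uI := words_isometry uW.
have u0 : u 0 = v by rewrite -wv wu.
split; first by rewrite -u0; case: uI.
have : '[w v - w lambda, w v - w lambda] = '[v - lambda, v - lambda].
  by rewrite !(affine_isometry_sub _ _ wI); case: wI => _ _ -> _ _.
rewrite wv wl sub0r !formE (formC D lambda v); lra.
Qed.

Lemma finite_nearest : finite_set nearest.
Proof.
apply: (@sub_finite_set _ _ ((fun w : V -> V => xget 0 [set y | w y = 0]) @` stab_affine)).
  move=> v /nearest_orbit0[w wS wv]; exists w => //.
  have [u [uW wu uw]] := words_inv (proj1 wS).
  have wy := @xgetPex _ 0 [set y | w y = 0] (ex_intro _ v wv).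
  by apply: (can_inj wu); rewrite [LHS]wy wv.
exact/finite_image/finite_stab_affine.
Qed.

(** If (u v, alpha i) < 0, the norm inequality for the reflected point forces (lambda, alpha i) = 0,
    so the reflection fixes [lambda]. *)
Lemma nearest_dominant_orbit v : nearest v ->
  exists u, stab_weyl u /\ dominant D (u v).
Proof.
move=> vN; have [||u i uS ui|u uS ud] := @exists_dominant_orbit stab_weyl v.
- exact: finite_stab_weyl.
- by split=> //; apply: words_id.
- case: (uS) => uW u0 ul; split.
  + exact: words_comp (words_gen (Some i)) uW.
  + by rewrite /= u0 -[RHS](gen_simple0 i).
  have [uvL uvE] := nearest_stab_weyl uS vN.
  rewrite -[LHS]/(gen (Some i) (u lambda)) ul; apply/gen_fix/eqP.
  have iR := simple_root i.
  rewrite pairing_eq0 // eq_le alcove_simple // andbT leNgt; apply/negP => li.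
  have := lattice_norm_ge hlambda (lattice_refl uvL iR).
  rewrite refl_norm // uvE !formE (formC D (alpha i)).
  have : pairing (u v) (alpha i) < 0 by rewrite pairing_lt0.
  by rewrite leNgt => h /negP; apply; nra.
- by exists u; split=> //; apply/dominantE.
Qed.

Lemma nearest_dominant_beta1 v : nearest v -> dominant D v -> v != 0 ->
  '[v, beta1] = 2.
Proof.
move=> vN /dominantE dv v0; have [b1 b2 b3] := largest_shortP (short_connectedT D).
have dv' : dominant_on [set: 'I_(rank D)]%SET v by move=> i _; apply: dv.
by have [] := nearest_sub_largest hlambda (@connectedT _ _ D) b1 b2 b3 vN v0
  (supportedT D v) dv'.
Qed.

Lemma nearest_dominant_scale v (c : R) : nearest v -> dominant D v ->
  0 <= c <= 1 / 2 -> alcove (c *: v).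
Proof.
move=> vN dv /andP[c0 c1]; have /dominantE dv' := dv.
split; first by apply/dominantE => i; rewrite formZl mulr_ge0.
rewrite -/(pairing _ _) pairing_short ?short_beta1 // formZl.
have [->|v0] := eqVneq v 0; first by rewrite form0l mulr0 ler01.
by rewrite nearest_dominant_beta1 //; lra.
Qed.

(** The halves of both points lie in the alcove, a strict fundamental domain. *)
Lemma nearest_dominant_uniq u v : nearest v -> dominant D v -> words u -> u 0 = 0 ->
  nearest (u v) -> dominant D (u v) -> u v = v.
Proof.
move=> vN dv uW u0 uvN duv.
have h : 0 <= (1 / 2 : R) <= 1 / 2 by lra.
have vA := nearest_dominant_scale vN dv h.
have uvA := nearest_dominant_scale uvN duv h.
rewrite -wordsZ // in uvA; have [E _] := alcove_strict_domain uW vA uvA.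
move: E; rewrite wordsZ // => /scalerI; apply.
by rewrite mulf_neq0 ?oner_eq0 // invr_eq0 pnatr_eq0.
Qed.

(* The length of the shortest element of the affine Weyl group mapping [v] to 0. *)
Definition translation_len (v : V) : R :=
  \sum_(a <- posroots) (if 0 < pairing v a then pairing v a - 1 else - pairing v a).

(* The length of the shortest element of the Weyl group making [v] dominant. *)
Definition inversion_len (v : V) : R := \sum_(a <- posroots) (pairing v a < 0)%R%:R.

Lemma crossing_preim0 d v a : words d -> d v = 0 ->
  crossing d a = - pairing v a + alcove_floor D a - alcove_floor D (lin d a).
Proof.
move=> dW dv; rewrite (crossing_gap v _ (words_isometry dW)) dv.
rewrite /gap pairing0l; ring.
Qed.

Lemma gap0 a : gap 0 a = 0 <-> positive a.
Proof.
rewrite /gap pairing0l sub0r /alcove_floor; case: ifP => _; rewrite ?oppr0 // opprK.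
by split=> // /eqP; rewrite oner_eq0.
Qed.

(** The crossing number at [a] is [- pairing v a], plus 1 if the image root is negative; minimality
    at 0 ties that sign to the pairing. *)
Lemma len_translation d v : words d -> d v = 0 -> no_descent D d 0 ->
  len d = translation_len v.
Proof.
move=> dW dv nd; apply: eq_big_seq => a aP; have aR := posroots_root aP.
have aP' : positive a by move: aP; rewrite mem_posroots => /andP[].
have dI := words_isometry dW.
have := crossing_preim0 a dW dv; rewrite {1}/alcove_floor aP' addr0.
rewrite /alcove_floor; case: ifP => p kE.
  have := no_descent_root dW (alcove0 D) nd aR (proj2 (gap0 _) p).
  rewrite kE subr0 oppr_ge0 => h; rewrite ltNge h /=.
  by rewrite ger0_norm // oppr_ge0.
have p' : positive (lin d (- a)).
  by rewrite (linN _ dI) positive_opp ?p // lin_root.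
have := no_descent_root dW (alcove0 D) nd (root_opp aR) (proj2 (gap0 _) p').
rewrite crossingN // kE => h; rewrite ifT; last lra.
by rewrite ler0_norm; lra.
Qed.

(** As [d] fixes 0, it has crossing number 1 at the positive roots made negative and 0 at the
    others. Minimality at [x] excludes negative images orthogonal to [x]. *)
Lemma len_inversion d v x : words d -> d 0 = 0 -> alcove x -> d v = x ->
  no_descent D d x -> len d = inversion_len v.
Proof.
move=> dW d0 xA dv nd; apply: eq_big_seq => a aP; have aR := posroots_root aP.
have aP' : positive a by move: aP; rewrite mem_posroots => /andP[].
have dI := words_isometry dW; have daR := lin_root dW aR.
have := crossing_preim0 a dW d0; rewrite pairing0l oppr0 add0r.
rewrite {1}/alcove_floor aP' sub0r => kE.
have vE : pairing v a = pairing x (lin d a).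
  by rewrite -dv (words_linear v dW d0) pairing_lin.
rewrite vE kE /alcove_floor; case: ifP => p.
  by rewrite oppr0 normr0 ltNge pairing_ge0 // alcove_ge0.
rewrite opprK normr1; case: ltP => // h.
have p' : positive (- lin d a) by rewrite positive_opp ?p.
have x0 : pairing x (- lin d a) = 0.
  apply/eqP; rewrite eq_le pairing_ge0 ?root_oppE // (alcove_ge0 xA p') andbT.
  by rewrite pairingNr oppr_le0.
have := no_descent_root dW xA nd (root_opp aR); rewrite (linN _ dI) /gap.
rewrite x0 /alcove_floor p' subrr => /(_ erefl).
by rewrite crossingN // kE /alcove_floor p; lra.
Qed.

(** With p the pairing, a summand is |p| - [p != 0], whose sum is invariant under [u], plus [p < 0],
    which vanishes for the dominant [x]. *)
Lemma translation_len_orbit u v x : words u -> u 0 = 0 -> u v = x ->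
  dominant D x -> translation_len v = translation_len x + inversion_len v.
Proof.
move=> uW u0 uv /dominantE dx; have uI := words_isometry uW.
pose F y a := `|pairing y a| - (pairing y a != 0)%:R.
have FE y a : (if 0 < pairing y a then pairing y a - 1 else - pairing y a) =
    F y a + (pairing y a < 0)%R%:R.
  rewrite /F; case: ltgtP => h; rewrite ?addr0.
  - by rewrite gtr0_norm.
  - by rewrite ltr0_norm // subrK.
  - by rewrite -h normr0 ?eqxx !subr0 oppr0.
have E y : translation_len y = \sum_(a <- posroots) F y a + inversion_len y.
  by rewrite -big_split; apply: eq_bigr => a _; apply: FE.
have inv0 : inversion_len x = 0.
  rewrite /inversion_len big_seq big1 // => a; rewrite mem_posroots => /andP[aR pa].
  have dx' : dominant_on [set: 'I_(rank D)]%SET x by move=> i _; apply: dx.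
  by rewrite ltNge pairing_ge0 // (dominant_on_form dx' (supportedT D a) pa).
rewrite !E inv0 addr0; congr (_ + _).
have Fe a : a \in roots D -> F x (- a) = F x a.
  by rewrite /F pairingNr normrN oppr_eq0.
rewrite -(@sum_posroots_lin _ _ D _ u (F x) uW Fe); apply: eq_bigr => a _.
by rewrite /F -uv (words_linear v uW u0) pairing_lin.
Qed.

(** The pairing of [v] with a positive root is 0, 1 or 2. Pairing 0 counts for both multiples,
    pairing 1 for neither, and pairing 2 only for the half. *)
Lemma max_len_diff v : nearest v -> dominant D v -> v != 0 ->
  max_len D ((1 / 2) *: v) - max_len D ((1 / 4) *: v) = translation_len v.
Proof.
move=> vN dv v0; rewrite /max_len /translation_len -sumrB; apply: eq_big_seq => a aP.
have aR := posroots_root aP.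
have pa : positive a by move: aP; rewrite mem_posroots => /andP[].
have h : 0 <= (1 / 2 : R) <= 1 / 2 by lra.
have A := nearest_dominant_scale vN dv h.
have := alcove_le1 A aR; have : 0 <= pairing ((1 / 2) *: v) a.
  by rewrite pairing_ge0 // (alcove_ge0 A pa).
have := pairing_lattice (proj1 vN) aR.
rewrite /gap /alcove_floor pa !subr0 !pairingZl; set n := pairing v a => nZ n0 n2.
have [->|n0'] := eqVneq n 0; first by rewrite !mulr0 !eqxx ltxx oppr0 subrr.
have n1 : 0 < n by rewrite lt_def n0' /=; lra.
rewrite n1; have n1' := int_lt_le1 (rpred0 _) nZ n1.
have [->|nD] := eqVneq n 1.
  have -> : (1 / 2 * 1 == 0 :> R) = false by apply/eqP; lra.
  have -> : (1 / 2 * 1 == 1 :> R) = false by apply/eqP; lra.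
  have -> : (1 / 4 * 1 == 0 :> R) = false by apply/eqP; lra.
  have -> : (1 / 4 * 1 == 1 :> R) = false by apply/eqP; lra.
  by rewrite !subrr.
have n1'' : 1 < n by rewrite lt_def nD; lra.
have n2' := int_lt_le1 (rpred1 _) nZ n1''.
have -> : n = 2 by apply/eqP; rewrite eq_le; apply/andP; split; lra.
have -> : (1 / 2 * 2 == 0 :> R) = false by apply/eqP; lra.
have -> : (1 / 2 * 2 == 1 :> R) = true by apply/eqP; lra.
have -> : (1 / 4 * 2 == 0 :> R) = false by apply/eqP; lra.
have -> : (1 / 4 * 2 == 1 :> R) = false by apply/eqP; lra.
by rewrite /=; lra.
Qed.

End Point.

Lemma stab_weylE lambda : stabiliser (weyl D) lambda = stab_weyl lambda.
Proof.
rewrite /stabiliser weylE /stab_weyl; apply/seteqP.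
by split=> w /= => [[[]]|[]].
Qed.

Lemma stab_affineE lambda : stabiliser (affine_weyl D) lambda = stab_affine lambda.
Proof. by rewrite /stabiliser affine_weylE. Qed.

Lemma gen_fix_simple i x : '[x, alpha i] = 0 -> gen (Some i) x = x.
Proof. by move=> h; apply/gen_fix/eqP; rewrite pairing_eq0 ?simple_root //= h. Qed.

(** * Stabilisers of multiples of a dominant nearest point *)

Section Extension.
Variables (lambda xi : V) (hlambda : alcove lambda).
Hypotheses (xiN : nearest D lambda xi) (xid : dominant D xi) (xi0 : xi != 0).

Lemma gen_None_scale (c : R) : gen None (c *: xi) = c *: xi <-> c * 2 = 1.
Proof.
rewrite gen_fix /= pairingNr pairing_short ?short_beta1 // formZl.
rewrite (nearest_dominant_beta1 hlambda xiN) //.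
by split=> [|->]; first lra.
Qed.

(** A quarter of [xi] lies in the alcove but off the wall of [s0], so its stabiliser is generated by
    the simple reflections fixing [xi]. Half of [xi] is on that wall. *)
Lemma stab_weyl_quarter : stabiliser (weyl D) xi = stab_affine ((1 / 4) *: xi).
Proof.
have quarter : (1 / 4 * 2 : R) <> 1 by lra.
have A : alcove ((1 / 4) *: xi) by apply: (nearest_dominant_scale hlambda xiN xid); lra.
rewrite stab_weylE; apply/seteqP; split=> w [wW].
  by move=> w0 wx; split=> //; rewrite wordsZ // wx.
move=> wx; have wA : alcove (w ((1 / 4) *: xi)) by rewrite wx.
have [_ [s sw sx]] := alcove_strict_domain wW A wA; split=> //; rewrite -sw.
  elim: s {sw} sx => // o s IH sx; rewrite ev_cons /= IH => [|o' o's]; last first.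
    by apply: sx; rewrite inE o's orbT.
  have := sx o (mem_head _ _); case: o sx => [i|] sx _ ; first exact: gen_simple0.
  by have /gen_None_scale := sx None (mem_head _ _) => /quarter.
elim: s {sw} sx => // o s IH sx; rewrite ev_cons /= IH => [|o' o's]; last first.
  by apply: sx; rewrite inE o's orbT.
have := sx o (mem_head _ _); case: o sx => [i|] sx.
  move=> /gen_fix/eqP; rewrite pairing_eq0 ?simple_root // formZl mulf_eq0.
  have -> /= : (1 / 4 == 0 :> R) = false by apply/eqP; lra.
  by move/eqP; apply: gen_fix_simple.
by move=> /gen_None_scale/quarter.
Qed.

Lemma ext_stabiliser_half : ext_stabiliser D xi = stab_affine ((1 / 2) *: xi).
Proof.
have A : alcove ((1 / 2) *: xi) by apply: (nearest_dominant_scale hlambda xiN xid); lra.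
apply/seteqP; split=> w.
  move: w; apply: generated_sub.
    have [W1 W2 W3] := words_group D.
    split=> [|f g [fW fx] [gW gx]|f g [fW fx] fg gf]; first by split.
      by split; [exact: W2 | rewrite /= gx fx].
    by split; [exact: W3 fW fg gf | rewrite -{1}fx fg].
  move=> w [|->].
    by rewrite stab_weylE => -[wW w0 wx]; split=> //; rewrite wordsZ // wx.
  split; first exact: (words_gen None).
  by apply/gen_None_scale; lra.
move=> [wW wx]; have wA : alcove (w ((1 / 2) *: xi)) by rewrite wx.
have [_ [s <- sx]] := alcove_strict_domain wW A wA.
have [G1 G2 G3] := generated_group (stabiliser (weyl D) xi `|` [set @s0 _ _ D]).
elim: s sx => // o s IH sx; apply: (G2 _ _ _ (IH _)) => [|o' o's]; last first.
  by apply: sx; rewrite inE o's orbT.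
have := sx o (mem_head _ _); case: o sx => [i|] sx /gen_fix /= h; apply: sub_generated.
  left; split; first exact: weyl_reflection (simple_root i).
  apply: (gen_fix_simple (i := i)); move/eqP: h.
  rewrite pairing_eq0 ?simple_root // formZl mulf_eq0.
  have -> /= : (1 / 2 == 0 :> R) = false by apply/eqP; lra.
  by move/eqP.
by right.
Qed.

End Extension.
End Orbits.

(** * Poincare polynomials *)

Lemma partition_fsbig (R : Type) (idx : R) (op : Monoid.com_law idx)
    (I J : choiceType) (A : set I) (B : set J) (f : I -> J) (F : I -> R) :
  finite_set A -> finite_set B -> (forall x, A x -> B (f x)) ->
  \big[op/idx]_(x \in A) F x =
    \big[op/idx]_(y \in B) \big[op/idx]_(x \in A `&` [set x | f x = y]) F x.
Proof.
move=> Afin Bfin AB.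
under [RHS]eq_fsbigr => y _ do rewrite fsbig_mkcondr.
rewrite exchange_fsbig //; apply: eq_fsbigr => x /set_mem Ax.
rewrite (fsbigD1 (f x)) //=; last exact: AB.
rewrite mem_set // fsbig1 ?Monoid.mulm1 // => y [By yx].
by rewrite memNset // => /= xy; apply: yx.
Qed.

Lemma rmorph_fsum (R S : pzRingType) (h : {rmorphism R -> S}) (I : choiceType)
    (A : set I) (F : I -> R) : finite_set A ->
  h (\sum_(i \in A) F i) = \sum_(i \in A) h (F i).
Proof. by move=> Afin; rewrite !fsbig_finite // rmorph_sum. Qed.

Section PoincarePolynomials.
Variables (R : realType) (V : vectType R) (D : rootSystem V).

Local Notation "'[ u , v ]" := (form D u v) (at level 0).
Local Notation words := (words D).
Local Notation alcove := (fundamental_alcove D).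
Local Notation posroots := (posroots D).
Local Notation len := (len D).
Local Notation poincare := (poincare D).
Local Notation stab_weyl := (stab_weyl D).
Local Notation stab_affine := (stab_affine D).
Local Notation pairing := (pairing D).

Lemma poincare_neq0 H : finite_set H -> H idfun -> poincare H != 0.
Proof.
move=> Hfin Hid; apply/eqP => /(congr1 (horner_eval (1 : rat))).
rewrite /poincare rmorph_fsum // rmorph0.
rewrite (eq_fsbigr (fun=> 1)) => [|w _]; last first.
  by rewrite /= horner_evalE hornerXn expr1n.
rewrite fsbig_finite // big_const_seq count_predT iter_addr_0 => /eqP.
rewrite pnatr_eq0 -/(#|` fset_set H|)%fset cardfs_eq0 => /eqP H0.
have : idfun \in fset_set H by rewrite in_fset_set // mem_set.
by rewrite H0 inE.
Qed.

(** All coefficients are nonnegative, so the top power cannot cancel. *)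
Lemma size_poincare H w : finite_set H -> H w ->
  (forall u, H u -> (length D u <= length D w)%N) ->
  size (poincare H) = (length D w).+1.
Proof.
move=> Hfin Hw Hle; apply/eqP; rewrite eqn_leq; apply/andP; split.
  rewrite /poincare fsbig_finite // (leq_trans (size_sum _ _ _)) //.
  rewrite big_seq; apply/bigmax_leqP_seq => u; rewrite in_fset_set // => /set_mem Hu _.
  by rewrite size_polyXn ltnS Hle.
rewrite ltnNge; apply/negP => /leq_sizeP/(_ _ (leqnn _)) /eqP.
rewrite /poincare fsbig_finite // coef_sum (bigD1_seq w) ?fset_uniq //=; last first.
  by rewrite in_fset_set // mem_set.
rewrite coefXn eqxx paddr_eq0 ?ler01 ?oner_eq0 // sumr_ge0 // => u _.
by rewrite coefXn; case: (_ == _).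
Qed.

Lemma poincare_coset (G H : set (V -> V)) d : words d ->
  (forall w, G w <-> exists2 h, H h & w = h \o d) ->
  (forall h, H h -> length D (h \o d) = (length D h + length D d)%N) ->
  \sum_(w \in G) ('X^(length D w) : {poly rat}) = 'X^(length D d) * poincare H.
Proof.
move=> dW GE Hl; have [u [uW du ud]] := words_inv dW.
have -> : G = (fun h => h \o d) @` H.
  by apply/seteqP; split=> w; [move/GE => [h Hh ->]; exists h | move=> [h Hh <-]; apply/GE; exists h].
rewrite fsbig_image => [|h h' _ _ hh'].
  rewrite mulr_fsumr; apply: eq_fsbigr => h /set_mem Hh.
  by rewrite Hl // addnC exprD.
apply: funext => x; rewrite -(ud x); exact: (congr1 (fun f => f (u x)) hh').
Qed.

Lemma length_truncn w : words w -> length D w = Num.truncn (len w).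
Proof. by move=> wW; rewrite -length_len // natrK. Qed.

(** Both groups are stabilisers of alcove points, so their Poincare polynomials have degree
    [max_len]; [max_len_diff] gives the difference. *)
Lemma ell_truncn lambda xi : alcove lambda -> nearest D lambda xi ->
  dominant D xi -> xi != 0 -> ell D xi = Num.truncn (translation_len D xi).
Proof.
move=> hl xN xd x0.
have A2 : alcove ((1 / 2) *: xi) by apply: (nearest_dominant_scale hl xN xd); lra.
have A4 : alcove ((1 / 4) *: xi) by apply: (nearest_dominant_scale hl xN xd); lra.
have S y : alcove y -> exists2 n, (n%:R : R) = max_len D y &
    size (poincare (stab_affine y)) = n.+1.
  move=> yA; have [w [wW wy wl]] := exists_max_len yA.
  exists (length D w); first by rewrite length_len.
  apply: size_poincare => //; first exact: finite_stab.
  move=> u [uW uy]; rewrite -(ler_nat R) !length_len // wl; exact: stab_len_le.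
have [n nE sn] := S _ A2; have [m mE sm] := S _ A4.
rewrite /ell (stab_weyl_quarter hl xN xd x0) (ext_stabiliser_half hl xN xd x0).
rewrite size_divp ?sn ?sm /=; last by rewrite -size_poly_eq0 sm.
rewrite -(max_len_diff hl xN xd x0) -nE -mE.
have [k kE] : exists k, n = (m + k)%N.
  exists (n - m)%N; rewrite subnKC // -(ler_nat R) nE mE -subr_ge0.
  rewrite (max_len_diff hl xN xd x0) /translation_len big_seq sumr_ge0 // => a.
  rewrite mem_posroots => /andP[aR pa].
  have p0 : 0 <= pairing xi a.
    rewrite pairing_ge0 // (@dominant_on_form _ _ _ [set: 'I_(rank D)]%SET) //.
      by move=> i _; move/dominantE: xd; apply.
    exact: supportedT.
  case: ltP => h; last by rewrite oppr_ge0.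
  have := int_lt_le1 (rpred0 _) (pairing_lattice (proj1 xN) aR) h; lra.
by rewrite kE natrD addrAC subrr add0r natrK subSKn addKn.
Qed.

Section Sums.
Variables (lambda : V) (hlambda : alcove lambda).

Local Notation nearest := (nearest D lambda).

(** A minimal element at 0 is taken with [lambda] kept fixed; it also shows that this real number is
    a natural number. *)
Lemma translation_len_nat v : nearest v -> exists d,
  [/\ stab_affine lambda d, d v = 0, no_descent D d 0 &
    translation_len D v = (length D d)%:R].
Proof.
move=> /(nearest_orbit0 hlambda)[w [wW wl] wv].
have [||d [dW dl dv nd]] := exists_min_coset (F := [set lambda]) _ (alcove0 D) wW _ wv.
- by move=> _ ->.
- by move=> _ ->.
exists d; split=> //; first by split=> //; apply: dl.
by rewrite length_len // (len_translation dW dv nd).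
Qed.

Lemma poincare_translation_coset v : nearest v ->
  \sum_(w \in stab_affine lambda `&` [set w | w v = 0]) ('X^(length D w) : {poly rat}) =
  'X^(Num.truncn (translation_len D v)) * poincare (stab_weyl lambda).
Proof.
move=> vN; have [d [[dW dl] dv nd ->]] := translation_len_nat vN; rewrite natrK.
have [u [uW du ud]] := words_inv dW.
apply: poincare_coset => // [w|h [hW h0 hl]].
  split=> [[[wW wl] wv]|[h [hW h0 hl] ->]].
    exists (w \o u); last by apply: funext => x /=; rewrite du.
    split; first exact: words_comp.
      by rewrite /= -{1}dv du.
    by rewrite /= -{1}dl du.
  split; last by rewrite /= dv.
  by split; [exact: words_comp | rewrite /= dl].
apply/eqP; rewrite -(eqr_nat R) natrD !length_len //; last exact: words_comp.
by rewrite (len_comp_min hW dW (alcove0 D) h0 nd).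
Qed.

Lemma inversion_lenZ (c : R) v : 0 < c -> inversion_len D (c *: v) = inversion_len D v.
Proof.
move=> c0; apply: eq_bigr => a _.
by rewrite pairingZl pmulr_rlt0.
Qed.

Lemma poincare_inversion_coset xi v u : nearest xi -> dominant D xi ->
  stab_weyl lambda u -> u v = xi ->
  \sum_(w \in stab_weyl lambda `&` [set w | w v = xi])
    ('X^(length D w) : {poly rat}) =
  'X^(Num.truncn (inversion_len D v)) * poincare (stab_weyl lambda `&` stab_weyl xi).
Proof.
(* Minimal coset elements are taken at points of the alcove, which contains half of [xi]. *)
move=> xN xd [uW u0 ul] uv; pose c : R := 1 / 2.
have c0 : 0 < c by rewrite /c; lra.
have cI : injective (fun x : V => c *: x) by apply: scalerI; rewrite gt_eqF.
have xA : alcove (c *: xi) by apply: (nearest_dominant_scale hlambda xN xd); rewrite /c; lra.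
have [|||d [dW dl dv nd]] :=
    @exists_min_coset _ _ D [set x | x = lambda \/ x = 0] (c *: xi) (c *: v) u _ xA uW.
- by move=> x [->//|->]; apply: alcove0.
- by move=> x [->//|->].
- by rewrite (wordsZ _ _ uW u0) uv.
have d0 : d 0 = 0 by apply: dl; right.
have dlam : d lambda = lambda by apply: dl; left.
have dv' : d v = xi by apply: cI; rewrite /= -(wordsZ _ _ dW d0).
have [t [tW dt td]] := words_inv dW.
have -> : Num.truncn (inversion_len D v) = length D d.
  by rewrite length_truncn // (len_inversion dW d0 xA dv nd) inversion_lenZ.
apply: poincare_coset => // [w|h [[hW h0 hl] [_ _ hx]]].
  split=> [[[wW w0 wl] wv]|[h [[hW h0 hl] [_ _ hx]] ->]].
    have t0 : t 0 = 0 by rewrite -{1}d0 dt.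
    exists (w \o t); last by apply: funext => x /=; rewrite dt.
    have wtW := words_comp wW tW; split; split=> //=; rewrite ?t0 //.
      by rewrite -{1}dlam dt.
    by rewrite -{1}dv' dt.
  split; last by rewrite /= dv'.
  split; [exact: words_comp | by rewrite /= d0 | by rewrite /= dlam].
apply/eqP; rewrite -(eqr_nat R) natrD !length_len //; last exact: words_comp.
by rewrite (len_comp_min hW dW xA _ nd) // (wordsZ _ _ hW h0) hx.
Qed.

Definition preimage_point (x : V) (w : V -> V) : V := xget 0 [set y | w y = x].

Lemma preimage_pointP x w y : words w -> preimage_point x w = y <-> w y = x.
Proof.
move=> /words_inv[u [_ wu uw]].
have E := @xgetPex _ 0 [set y | w y = x] (ex_intro _ (u x) (uw x)).
split=> [<- //|wy]; apply: (can_inj wu); rewrite wy; exact: E.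
Qed.

(** Sort the stabiliser by the point sent to 0; each class is a coset of [stab_weyl lambda]. *)
Lemma poincare_stab_affine : poincare (stab_affine lambda) =
  (\sum_(v \in nearest) ('X^(Num.truncn (translation_len D v)) : {poly rat})) *
    poincare (stab_weyl lambda).
Proof.
rewrite mulr_fsuml /poincare.
rewrite (partition_fsbig (f := preimage_point 0) _ _ (finite_stab_affine hlambda)
  (finite_nearest hlambda)) => [|w wS]; last first.
  apply/(nearest_orbit0 hlambda); exists w => //.
  by apply/(preimage_pointP _ _ (proj1 wS)).
apply: eq_fsbigr => v /set_mem vN; rewrite -poincare_translation_coset //.
apply: eq_fsbigl; apply/seteqP.
by split=> w /= [wS] /(preimage_pointP _ _ (proj1 wS)).
Qed.

Definition weyl_orbit (xi : V) : set V :=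
  [set v | exists2 u, stab_weyl lambda u & u v = xi].

Lemma stab_weyl_inv u : stab_weyl lambda u ->
  exists t, [/\ stab_weyl lambda t, cancel u t & cancel t u].
Proof.
move=> [uW u0 ul]; have [t [tW ut tu]] := words_inv uW; exists t; split=> //.
by split=> //; [rewrite -{1}u0 ut | rewrite -{1}ul ut].
Qed.

Lemma weyl_orbit_nearest xi : nearest xi -> weyl_orbit xi `<=` nearest.
Proof.
move=> xN v [u uS uv]; have [t [tS ut tu]] := stab_weyl_inv uS.
by rewrite -(ut v) uv; apply: (nearest_stab_weyl tS).
Qed.

Lemma poincare_stab_weyl xi : nearest xi -> dominant D xi ->
  poincare (stab_weyl lambda) =
  (\sum_(v \in weyl_orbit xi)
      ('X^(Num.truncn (inversion_len D v)) : {poly rat})) *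
    poincare (stab_weyl lambda `&` stab_weyl xi).
Proof.
move=> xN xd; rewrite mulr_fsuml /(poincare (stab_weyl lambda)).
have fO := sub_finite_set (weyl_orbit_nearest xN) (finite_nearest hlambda).
rewrite [LHS](partition_fsbig (f := preimage_point xi) _ _ (finite_stab_weyl hlambda) fO)
  => [|w wS]; last first.
  exists w => //; have [wW _ _] := wS; exact/(preimage_pointP _ _ wW).
apply: eq_fsbigr => v /set_mem[u uS uv].
rewrite -(poincare_inversion_coset xN xd uS uv).
apply: eq_fsbigl; apply/seteqP.
by split=> w /= [wS]; have [wW _ _] := wS; move/(preimage_pointP _ _ wW).
Qed.

Lemma translation_len_add xi v : nearest xi -> dominant D xi -> weyl_orbit xi v ->
  Num.truncn (translation_len D v) =
  (Num.truncn (translation_len D xi) + Num.truncn (inversion_len D v))%N.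
Proof.
move=> xN xd [u [uW u0 ul] uv]; rewrite (translation_len_orbit uW u0 uv xd).
have [d [_ _ _ ->]] := translation_len_nat xN.
have -> : inversion_len D v = (\sum_(a <- posroots) (pairing v a < 0)%R)%:R.
  by rewrite natr_sum.
by rewrite -natrD !natrK.
Qed.

Lemma finite_summation_set : finite_set (summation_set D lambda).
Proof.
apply: sub_finite_set (finite_nearest hlambda) => xi /(summation_setP hlambda)[].
by [].
Qed.

Lemma nearest_sum :
  \sum_(v \in nearest) ('X^(Num.truncn (translation_len D v)) : {poly rat}) =
  1 + \sum_(xi \in summation_set D lambda) ('X^(ell D xi) : {poly rat}) *
    \sum_(v \in weyl_orbit xi) ('X^(Num.truncn (inversion_len D v)) : {poly rat}).
Proof.
have N0 : nearest 0 by split; [exact: lattice0 | rewrite !form0l mulr0].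
rewrite (fsbigD1 0) //=; last exact: finite_nearest.
congr (_ + _).
  rewrite /translation_len big1 ?truncn0 ?expr0 // => a _.
  by rewrite pairing0l ltxx oppr0.
(* The dominant point of the orbit of [v]; for nearest [v] it exists, so the default is not
   taken. *)
pose g v := xget 0 [set y | dominant D y /\ exists2 u, stab_weyl lambda u & u v = y].
have gP v : nearest v -> dominant D (g v) /\ weyl_orbit (g v) v.
  move=> vN; have [u [uS ud]] := nearest_dominant_orbit hlambda vN.
  have [|d1 [t tS tv]] := @xgetPex _ 0
    [set y | dominant D y /\ exists2 u, stab_weyl lambda u & u v = y].
    by exists (u v); split=> //; exists u.
  by split=> //; exists t.
have orb_neq0 u v : stab_weyl lambda u -> (u v == 0) = (v == 0).
  move=> uS; have [t [[_ t0 _] ut tu]] := stab_weyl_inv uS; have [_ u0 _] := uS.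
  by rewrite -{1}u0 (can_eq ut).
have gS v : (nearest `\ 0) v -> summation_set D lambda (g v).
  move=> [vN v0]; apply/(summation_setP hlambda).
  have [gd [u uS uv]] := gP v vN; split=> //.
    by rewrite -uv; apply: nearest_stab_weyl.
  by rewrite -uv orb_neq0 //; apply/eqP.
rewrite (partition_fsbig (f := g) _ _ _ finite_summation_set gS); last first.
  by apply: finite_setD; apply: finite_nearest.
apply: eq_fsbigr => xi /set_mem /(summation_setP hlambda)[xN xd x0].
have -> : (nearest `\ 0) `&` [set v | g v = xi] = weyl_orbit xi.
  apply/seteqP; split=> v /=; first by move=> [[vN _] <-]; have [] := gP v vN.
  move=> vO; have vN := weyl_orbit_nearest xN vO; have [u uS uv] := vO.
  split; first by split=> //; apply/eqP; rewrite -(orb_neq0 u) // uv.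
  have [gd [t tS tv]] := gP v vN; have [s [sS us su]] := stab_weyl_inv uS.
  have E : g v = (t \o s) xi by rewrite /= -uv us.
  have [tW t0 _] := tS; have [sW s0' _] := sS.
  rewrite E; apply: (nearest_dominant_uniq hlambda xN xd).
  - exact: words_comp.
  - by rewrite /= s0'.
  - rewrite -E -tv; exact: nearest_stab_weyl.
  - by rewrite -E.
rewrite mulr_fsumr; apply: eq_fsbigr => v /set_mem vO.
rewrite (translation_len_add xN xd vO) exprD.
by rewrite (ell_truncn hlambda xN xd x0).
Qed.

End Sums.
End PoincarePolynomials.

Theorem theorem1 (R : realType) (V : vectType R) (D : rootSystem V)
    (lambda : V) (hlambda : fundamental_alcove D lambda) :
  poincare_quotient D (stabiliser (affine_weyl D) lambda)
                      (stabiliser (weyl D) lambda) =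
  1 + \sum_(xi \in summation_set D lambda)
        tofrac ('X^(ell D xi)) *
        poincare_quotient D (stabiliser (weyl D) lambda)
          (stabiliser (weyl D) lambda `&` stabiliser (weyl D) xi).
Proof.
have Wid x : stab_weyl D x idfun by split=> //; apply: words_id.
have fW := finite_stab_weyl hlambda.
have PW : tofrac (poincare D (stab_weyl D lambda)) != 0.
  by rewrite tofrac_eq0 poincare_neq0.
have fS := finite_summation_set hlambda.
rewrite stab_affineE stab_weylE /poincare_quotient (poincare_stab_affine hlambda).
rewrite tofracM mulfK // nearest_sum // tofracD tofrac1 rmorph_fsum //.
congr (_ + _); apply: eq_fsbigr => xi /set_mem /(summation_setP hlambda)[xN xd x0].
rewrite /= tofracM (stab_weylE D xi); congr (_ * _); symmetry.
(* The orbit sum is the quotient of the Poincare polynomials of [W_lambda] and its intersection with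
   the stabiliser of [xi]. *)
have E := poincare_stab_weyl hlambda xN xd.
have nz : tofrac (poincare D (stab_weyl D lambda `&` stab_weyl D xi)) != 0.
  rewrite tofrac_eq0; apply: poincare_neq0; last by split; apply: Wid.
  by apply: sub_finite_set fW => w [].
by apply: (canLR (mulfK nz)); rewrite -tofracM; congr (tofrac _).
Qed.
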